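(* Let $A=(2\;\;2\;\;-2)$ and $r\ge2$. There exist constants $c,C>0$ such that $$\lim_{n\to\infty}\mathbb P\big[(\mathbb Z_4)^n_p\text{ is }(A,r)\text{-Rado}\big]=\begin{cases}0 & \text{if } p\le c\,4^{-3n/4};\\ 1 & \text{if } p\ge C\,4^{-3n/4}.\end{cases}$$
   Context: $(\mathbb Z_4)^n$ is the $n$-fold direct product of the cyclic group $\mathbb Z_4$, and $(\mathbb Z_4)^n_p$ is its random subset containing each element independently with probability $p$. A subset $S$ is $(A,r)$-Rado if every $r$-colouring of $S$ yields a monochromatic triple $(x_1,x_2,x_3)$ of pairwise distinct elements of $S$ with $2x_1+2x_2-2x_3=0$. *)

(* Defs.v *)
From mathcomp Require Import all_boot all_order all_algebra.
From mathcomp Require Import all_classical all_reals all_analysis.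

Set Implicit Arguments.
Unset Strict Implicit.
Unset Printing Implicit Defensive.

Import Order.TTheory GRing.Theory Num.Theory.
Import numFieldNormedType.Exports.

Local Open Scope ring_scope.

(* Integer coefficients act on the abelian group G by x *~ a. *)
Definition is_solution (l k : nat) (A : 'M[int]_(l, k)) (G : zmodType)
    (x : 'I_k -> G) : bool :=
  [forall i : 'I_l, \sum_(j < k) x j *~ A i j == 0].

(* Only solutions with pairwise distinct entries count. *)
Definition is_rado (l k : nat) (A : 'M[int]_(l, k)) (r : nat)
    (G : finZmodType) (S : {set G}) : bool :=
  [forall chi : {ffun {s : G | s \in S} -> 'I_r},
    [exists x : {ffun 'I_k -> {s : G | s \in S}},
      [&& injectiveb x,
          is_solution A (fun j => val (x j))
        & [forall i, forall j, chi (x i) == chi (x j)]]]].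

(* Probability that the random subset of T containing each element
   independently with probability p satisfies E. *)
Definition prob_random_subset (R : realType) (T : finType) (p : R)
    (E : pred {set T}) : R :=
  \sum_(S : {set T} | E S) p ^+ #|S| * (1 - p) ^+ #|~: S|.

Definition A22m2 : 'M[int]_(1, 3) :=
  \matrix_(i < 1, j < 3) [:: 2; 2; -2]`_j.

(* Main.v *)
Require Import Defs.
From HB Require Import structures.
From mathcomp Require Import all_boot all_order all_algebra.
From mathcomp Require Import zify lra ring.
From mathcomp Require boolp.
From mathcomp Require Import reals.

Set Implicit Arguments.
Unset Strict Implicit.
Unset Printing Implicit Defensive.

Import Order.TTheory GRing.Theory Num.Theory.

Local Open Scope ring_scope.

(** Reduction modulo 2 maps solutions onto triples [u + v + w = 0] of [V = F_2^n],
    each point of [V] (put [N = 2^n]) being hit with probability about [q = N p], so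
    the threshold reads [q = N^(-1/2)].

    Below it, a set of nonzero points that is not 2-colourable contains a minimal
    one, in which every point lies in two triples. Following triples as long as they
    leave the span yields [k] generators and [2k + 1] points of their span; there are
    at most [(8 N)^k] such configurations for given chain lengths, and the expected
    number [q (8 N q^2)^k] is summable and tends to 0.

    Above it, each colour class is sum-free, hence caught by a container determined
    by [O(N^(1/2))] of its points: collect about [N^(1/2)] points of large degree, then
    run the Kleitman-Winston algorithm in the Cayley graph they generate, and iterate.
    By a supersaturated Schur theorem [r] containers with few Schur triples miss a
    positive proportion of [V], which the random set avoids with probability
    small enough for the union bound over fingerprints. *)

(** * Sum-free sets and Schur triples in groups of exponent 2 *)

Section SumFree.
Variables (V : finZmodType) (V2 : forall x : V, x + x = 0).
Implicit Types (A B I T X : {set V}) (x y : V).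

Definition sum_free A := forall x y, x \in A -> y \in A -> x + y \notin A.

Definition sum_deg A x := #|[set y in A | x + y \in A]|.

Definition schur_pairs A := (\sum_(x in A) sum_deg A x)%N.

Lemma sum_deg_sub A B x : A \subset B -> (sum_deg A x <= sum_deg B x)%N.
Proof.
move=> /subsetP sAB; apply/subset_leq_card/subsetP => y.
by rewrite !inE => /andP[/sAB-> /sAB->].
Qed.

Lemma addVK x y : x + (x + y) = y. Proof. by rewrite addrA V2 add0r. Qed.

(** A lost [y] either lies in [A :\: B] or is the translate by [x] of a point there, whence the
    factor 2. *)
Lemma sum_deg_setD A B x : (sum_deg A x <= sum_deg B x + 2 * #|A :\: B|)%N.
Proof.
have sub : [set y in A | x + y \in A] \subset
   [set y in B | x + y \in B] :|: (A :\: B) :|: [set x + z | z in A :\: B].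
  apply/subsetP=> y; rewrite !inE => /andP[yA xyA].
  case: (boolP (y \in B)) => yB; last by rewrite yA orbT.
  case: (boolP (x + y \in B)) => xyB //=.
  apply/imsetP; exists (x + y); first by rewrite inE xyA xyB.
  by rewrite addVK.
apply: leq_trans (subset_leq_card sub) _.
rewrite mul2n -addnn addnA.
apply: leq_trans (leq_card_setU _ _) _; apply: leq_add; last exact: leq_imset_card.
exact: leq_card_setU.
Qed.

Section Supersaturation.
Variables (r : nat) (C : 'I_r -> {set V}).
Hypothesis r_gt0 : (0 < r)%N.
Let N := #|V|.
Let U := \bigcup_i C i.

(** One step of Schur's argument. Pairs of [X] rarely sum into a colour outside [J], so some
    translate [b + X] lies largely in the colours of [J]; [X'] is its part in a frequent colour [i].
    Pairs of [X'] summing into [C i] are Schur pairs of [C i]; for the other colours, translation by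
    [b] preserves pairwise sums. *)
Lemma schur_step (e u a : nat) (J : {set 'I_r}) (X : {set V}) :
  (forall i, schur_pairs (C i) <= e)%N -> (#|~: U| <= u)%N ->
  (forall i, i \notin J -> \sum_(x in X) #|[set y in X | (x + y)%R \in C i]| <= e)%N ->
  (a <= #|X|)%N -> (2 * r * e + 2 * a * u < a * a)%N ->
  exists i, exists2 X' : {set V}, i \in J /\ (a <= #|X'| * (2 * r))%N &
   forall j, j \notin J :\ i -> (\sum_(x in X') #|[set y in X' | (x + y)%R \in C j]| <= e)%N.
Proof.
move=> eC uC eX aX small.
(* Averaging over [b]: each of the at most [r] colours outside [J] receives at most [e] pairs. *)
have [b bX hb] : exists2 b, b \in X &
    (a * \sum_(i | i \notin J) #|[set y in X | (b + y)%R \in C i]| <= r * e)%N.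
  apply/exists_inP; apply: contraT; rewrite negb_exists => /forallP H.
  have tot : (\sum_(b in X) \sum_(i | i \notin J) #|[set y in X | (b + y)%R \in C i]| <= r * e)%N.
    rewrite exchange_big /=; apply: (@leq_trans (\sum_(i | i \notin J) e)).
      by apply: leq_sum => i; exact: eX.
    by rewrite sum_nat_const leq_mul2r (leq_trans (max_card _)) ?card_ord ?orbT.
  have a0 : (0 < a)%N by move: small; case: (a).
  have X0 : (0 < #|X|)%N by apply: leq_trans aX.
  have : (\sum_(b in X) (r * e).+1 <=
          a * \sum_(b in X) \sum_(i | i \notin J) #|[set y in X | (b + y)%R \in C i]|)%N.
    rewrite big_distrr /=; apply: leq_sum => b bX; rewrite ltnNge.
    by have := H b; rewrite bX.
  rewrite sum_nat_const => h.
  have h2 := leq_trans h (leq_mul (leqnn a) tot).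
  have h3 := leq_mul aX (leqnn (r * e).+1).
  nia.
pose Y i := [set b + y | y in X] :&: C i.
have cov : (#|X| <= \sum_(i | i \notin J) #|[set y in X | (b + y)%R \in C i]| + u
       + \sum_(i in J) #|Y i|)%N.
  have -> : #|X| = #|[set b + y | y in X]| by rewrite card_imset //; exact: addrI.
  have sub : [set b + y | y in X] \subset \bigcup_(i | i \notin J) Y i :|: ~: U
      :|: \bigcup_(i in J) Y i.
    apply/subsetP => z zX; rewrite !in_setU in_setC.
    case: (boolP (z \in U)) => [/bigcupP[i _ zC]|]; last by rewrite orbT.
    case: (boolP (i \in J)) => iJ.
      by apply/orP; right; apply/bigcupP; exists i => //; rewrite inE zX zC.
    by apply/orP; left; rewrite orbF; apply/bigcupP; exists i => //; rewrite inE zX zC.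
  have cardbig (P : pred 'I_r) : (#|\bigcup_(i | P i) Y i| <= \sum_(i | P i) #|Y i|)%N.
    by elim/big_rec2: _ => [|i m B _ h]; rewrite ?cards0 //;
       apply: leq_trans (leq_card_setU _ _) _; rewrite leq_add2l.
  apply: leq_trans (subset_leq_card sub) _.
  apply: leq_trans (leq_card_setU _ _) _; apply: leq_add (cardbig _).
  apply: leq_trans (leq_card_setU _ _) _; apply: leq_add uC.
  apply: leq_trans (cardbig _) _; apply: leq_sum => i _.
  have -> : Y i = [set b + y | y in [set y in X | b + y \in C i]].
    apply/setP => z; rewrite inE; apply/andP/imsetP => [[/imsetP[y yX ->] bC]|[y]].
      by exists y => //; rewrite inE yX bC.
    by rewrite inE => /andP[yX bC] ->; split => //; apply/imsetP; exists y.
  exact: leq_imset_card.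
(* By [small], fewer than [a / 2] points of [b + X] are uncovered or in colours outside [J]; the
   others are shared by at most [r] colours. *)
have [i iJ hi] : exists2 i, i \in J & (a <= #|Y i| * (2 * r))%N.
  apply/exists_inP; apply: contraT; rewrite negb_exists => /forallP H.
  have h : ((\sum_(i in J) #|Y i|) * (2 * r) <= a * r)%N.
    rewrite big_distrl /=; apply: (@leq_trans (\sum_(i in J) a)).
      by apply: leq_sum => i iJ; rewrite ltnW // ltnNge; have := H i; rewrite iJ.
    by rewrite sum_nat_const mulnC leq_mul2l (leq_trans (max_card _)) ?card_ord ?orbT.
  have h2 : (2 * \sum_(i in J) #|Y i| <= a)%N.
    by rewrite -(leq_pmul2r r_gt0); apply: leq_trans h; rewrite mulnCA mulnA.
  move: hb cov h2; set s1 := (\sum_(i | _) _)%N; set s2 := (\sum_(i in J) _)%N => hb cov h2.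
  have := leq_trans aX cov => h3.
  nia.
exists i, (Y i); first by [].
move=> j; rewrite in_setD1 negb_and negbK.
case: (boolP (j == i)) => [/eqP-> _|ji /= jJ].
  apply: leq_trans (eC i); rewrite /schur_pairs.
  have sY : {subset Y i <= C i} by move=> z; rewrite inE => /andP[].
  rewrite [leqLHS]big_mkcond [leqRHS]big_mkcond /=; apply: leq_sum => x _.
  case: ifP => // xY; rewrite (sY _ xY); apply/subset_leq_card/subsetP => y.
  by rewrite !inE => /andP[/andP[_ ->] ->].
apply: leq_trans (eX _ jJ).
have inX z : z \in Y i -> b + z \in X.
  by rewrite inE => /andP[/imsetP[y yX ->] _]; rewrite addVK.
rewrite (reindex_inj (addrI b)) /= [leqLHS]big_mkcond [leqRHS]big_mkcond /=.
apply: leq_sum => x _; case: ifP => // xY.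
rewrite -[x](addVK b) (inX _ xY) addVK.
rewrite -(card_imset _ (addrI b)); apply/subset_leq_card/subsetP => z /imsetP[y].
rewrite !inE => /andP[yY xyC] ->; rewrite (inX y) /=; last by rewrite inE.
by have -> : x + (b + y) = b + x + y by rewrite addrA [x + b]addrC.
Qed.

(** After multiplication by [2 * (P * P)], each term on the left is at most [(m * P) ^ 2], the first
    one strictly less. *)
Lemma schur_arith (n m P u e : nat) : (n <= m * P -> 4 * r * (P * P) * e < n ^ 2 ->
  4 * P * u <= n -> 2 * r * e + 2 * m * u < m * m)%N.
Proof.
move=> h1 h2 h3.
have h4 : (n ^ 2 <= (m * P) * (m * P))%N by rewrite -mulnn leq_mul.
have h5 : ((m * P) * (4 * P * u) <= (m * P) * (m * P))%N by rewrite leq_mul // (leq_trans h3).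
have P0 : (0 < 2 * (P * P))%N by move: (leq_trans h2 h4); case: (P) => //; rewrite !muln0.
rewrite -(ltn_pmul2l P0); nia.
Qed.

(** Iterate [schur_step] from [J = setT] and [X = setT]; each step removes a colour from [J] and
    divides the size of [X] by at most [2 * r]. If few points were uncovered, a step would remain
    possible with [J] empty, yet it produces an element of [J]. *)
Lemma schur_supersaturation :
  (forall i, 4 * r * (2 * r) ^ (2 * r) * schur_pairs (C i) < N ^ 2)%N ->
  (N < 4 * (2 * r) ^ r * #|~: U|)%N.
Proof.
move=> sm; rewrite ltnNge; apply/negP => hU.
pose e := \max_i schur_pairs (C i).
have eC i : (schur_pairs (C i) <= e)%N by exact: leq_bigmax.
have he : (4 * r * (2 * r) ^ (2 * r) * e < N ^ 2)%N.
  have [i0 ->] : {i0 | e = schur_pairs (C i0)} by apply: bigop.eq_bigmax; rewrite card_ord.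
  exact: sm.
suff H k (J : {set 'I_r}) X : #|J| = k -> (N <= #|X| * (2 * r) ^ (r - k))%N ->
   (forall i, i \notin J -> \sum_(x in X) #|[set y in X | (x + y)%R \in C i]| <= e)%N -> False.
  apply: (H r setT setT); rewrite ?cardsT ?card_ord ?subnn ?expn0 ?muln1 //.
  by move=> i; rewrite inE.
move=> cJ; have kr : (k <= r)%N by rewrite -cJ -[leqRHS]card_ord max_card.
elim: k J X cJ kr => [|k IH] J X cJ kr hX hJ;
  have small : (2 * r * e + 2 * #|X| * #|~: U| < #|X| * #|X|)%N.
1,3: apply: (@schur_arith N _ ((2 * r) ^ r)%N) => //;
  [ apply: leq_trans hX _; rewrite leq_mul2l leq_pexp2l ?orbT ?muln_gt0 ?leq_subr //
  | by rewrite -expnD addnn -mul2n ].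
  have [i [X' [iJ _] _]] := schur_step eC (leqnn _) hJ (leqnn _) small.
  by move: iJ; rewrite (cards0_eq cJ) inE.
have [i [X' [iJ h] h']] := schur_step eC (leqnn _) hJ (leqnn _) small.
apply: IH h' => //; first by move: cJ; rewrite (cardsD1 i) iJ => -[].
  exact: ltnW.
apply: leq_trans hX _; rewrite (_ : (r - k = (r - k.+1).+1)%N); last by rewrite -subSn.
by rewrite expnS mulnA leq_mul2r h orbT.
Qed.

End Supersaturation.
End SumFree.

(** * Containers for sum-free sets *)

Section Containers.
Variables (V : finZmodType) (V2 : forall x : V, x + x = 0).
Variables (R : realFieldType) (w L : R).
Hypotheses (w0 : 0 <= w) (L1 : 1 <= L).
Variable E : nat.
Implicit Types (A B I T : {set V}).
Let N := #|V|.

(* [sum_containers A T0 k]: the part in [A] of every sum-free [I] containing [T0]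
   is caught by a pair (fingerprint, container) of the list [l]; the sum over the
   fingerprints of [w ^+ #|T|] is bounded as if they were all the subsets of [A]
   of size at most [k]. *)
Definition sum_containers A T0 k :=
  exists l : seq ({set V} * {set V}),
  [/\ \sum_(x <- l) w ^+ #|x.1| <= L ^+ k * (1 + w / L) ^+ #|A|,
      {in l, forall x : {set V} * {set V}, [/\ x.1 \subset A, (#|x.1| <= k)%N &
                          (E * schur_pairs x.2 < N ^ 2)%N]}
    & forall I, sum_free I -> T0 \subset I ->
      exists2 x, x \in l & x.1 \subset I /\ I :&: A \subset x.1 :|: x.2].

Let wL : 1 <= 1 + w / L.
Proof. by rewrite lerDl divr_ge0 // (le_trans _ L1). Qed.

Lemma sum_containers_leaf A T0 k :
  (E * schur_pairs A < N ^ 2)%N -> sum_containers A T0 k.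
Proof.
move=> small; exists [:: (set0, A)]; split.
- by rewrite big_seq1 cards0 expr0 mulr_ege1 // exprn_ege1.
- by move=> x; rewrite inE => /eqP ->; rewrite cards0 sub0set.
- move=> I _ _; exists (set0, A); first by rewrite inE.
  by rewrite sub0set set0U subsetIr.
Qed.

Lemma sum_containersW A T0 k k' : (k <= k')%N ->
  sum_containers A T0 k -> sum_containers A T0 k'.
Proof.
move=> kk' [l [sl gl cl]]; exists l; split => //.
  apply: le_trans sl _; rewrite ler_wpM2r ?exprn_ge0 ?(le_trans _ wL) //.
  by rewrite ler_weXn2l.
by move=> x /gl[xA xk xs]; split => //; exact: leq_trans kk'.
Qed.

(** Sets missing [v] are served by [l1], sets containing [v] by [l2] with [v] added to the
    fingerprint. The weights add up exactly: the second bound, times [w], is the [w / L] share of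
    the new factor [1 + w / L]. *)
Lemma sum_containers_query v A T0 k : v \in A ->
  sum_containers (A :\ v) T0 k.+1 -> sum_containers (A :\ v) (v |: T0) k ->
  sum_containers A T0 k.+1.
Proof.
move=> vA [l1 [s1 g1 c1]] [l2 [s2 g2 c2]].
pose f (x : {set V} * {set V}) := (v |: x.1, x.2).
have vn x : x \in l2 -> v \notin x.1.
  by case/g2 => /subsetP h _ _; apply/negP => /h; rewrite !inE eqxx.
exists (l1 ++ map f l2); split.
- rewrite big_cat big_map /= (cardsD1 v A) vA [X in _ + X](_ : _ = w * \sum_(x <- l2) w ^+ #|x.1|).
    have -> : L ^+ k.+1 * (1 + w / L) ^+ (true + #|A :\ v|) =
      L ^+ k.+1 * (1 + w / L) ^+ #|A :\ v| + w * (L ^+ k * (1 + w / L) ^+ #|A :\ v|).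
      have Ln0 : L != 0 by rewrite gt_eqF // (lt_le_trans _ L1).
      by rewrite exprS exprD expr1; field.
    by rewrite lerD // ler_wpM2l.
  rewrite mulr_sumr !big_seq; apply: eq_bigr => x xl.
  by rewrite cardsU1 (vn x xl) exprS.
- move=> x; rewrite mem_cat => /orP[/g1[h1 h2 h3]|/mapP[y yl ->]].
    by split => //; apply: subset_trans h1 (subD1set _ _).
  have [h1 h2 h3] := g2 _ yl; split => //=.
    by rewrite subUset sub1set vA (subset_trans h1) // subD1set.
  by rewrite cardsU1 (vn y yl).
- move=> I sI TI; case: (boolP (v \in I)) => vI.
    have [|x xl [xI h]] := c2 _ sI; first by rewrite subUset sub1set vI.
    exists (f x); first by rewrite mem_cat map_f // orbT.
    rewrite /= subUset sub1set vI xI; split => //; apply/subsetP => z /setIP[zI zA].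
    case: (eqVneq z v) => [->|zv]; first by rewrite !inE eqxx.
    have := subsetP h z; rewrite !inE zI zv zA => /(_ isT) /orP[]->; by rewrite ?orbT.
  have [x xl [xI h]] := c1 _ sI TI; exists x; first by rewrite mem_cat xl.
  split => //; apply/subsetP => z /setIP[zI zA]; apply: (subsetP h).
  by rewrite !inE zI zA andbT; apply: contraNneq vI => <-.
Qed.

Lemma sum_containers_prune B A T0 k : B \subset A ->
  (forall I, sum_free I -> T0 \subset I -> I :&: A \subset B) ->
  sum_containers B T0 k -> sum_containers A T0 k.
Proof.
move=> BA IB [l [sl gl cl]]; exists l; split => //.
- apply: le_trans sl _; rewrite ler_wpM2l ?exprn_ge0 ?(le_trans _ L1) //.
  by rewrite ler_weXn2l // subset_leq_card.
- by move=> x /gl[xB xk xs]; split => //; exact: subset_trans BA.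
- move=> I sI TI; have [x xl [xI h]] := cl I sI TI; exists x => //; split => //.
  by apply: subset_trans h; rewrite subsetI subsetIl IB.
Qed.

(** * One round of the algorithm: removing [g] points from the container *)

Section Shrink.
Variables (t g k : nat) (A : {set V}).
Hypotheses (t0 : (0 < t)%N) (tN : (N <= t * t)%N).
Hypotheses (gN : (16 * E * g <= N)%N).
Hypothesis next : forall B T0, (#|B| + g <= #|A|)%N -> sum_containers B T0 k.

Let hdeg T B x := #|[set y in B | x + y \in T]|.

Let hdeg_le T B x : (hdeg T B x <= #|T|)%N.
Proof.
rewrite /hdeg -(card_imset _ (addrI x)); apply: subset_leq_card.
by apply/subsetP => z /imsetP[y]; rewrite inE => /andP[_ h] ->.
Qed.

(** Double counting of the pairs [x] in [B], [v] in [T] with [x + v] in [B]. *)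
Let sum_hdeg T B : (\sum_(x in B) hdeg T B x = \sum_(v in T) sum_deg B v)%N.
Proof.
transitivity (\sum_(x in B) \sum_(v in T) ((x + v)%R \in B))%N.
  apply: eq_bigr => x xB; rewrite /hdeg -(card_imset _ (addrI x)) -sum1_card.
  rewrite -[RHS]big_mkcondr /=; apply: eq_bigl => v; apply/imsetP/andP.
    by case=> y; rewrite inE => /andP[yB h] ->; rewrite addVK.
  by case=> vT xvB; exists (x + v); rewrite ?inE ?addVK ?xvB.
rewrite exchange_big /=; apply: eq_bigr => v vT.
rewrite /sum_deg -sum1_card -big_mkcondr /=; apply: eq_bigl => x.
by rewrite inE addrC.
Qed.

(** A deleted point has at most [#|T|] neighbours, and its edges are counted from both ends. *)
Let sum_hdeg_sub T B B' : B' \subset B ->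
  (\sum_(x in B) hdeg T B x <= \sum_(x in B') hdeg T B' x + 2 * #|B :\: B'| * #|T|)%N.
Proof.
move=> sB.
have split1 : (\sum_(x in B) hdeg T B x <= \sum_(x in B') hdeg T B x + #|B :\: B'| * #|T|)%N.
  rewrite (big_setID B') /= (setIidPr sB) leq_add2l -sum_nat_const.
  by apply: leq_sum => x _; exact: hdeg_le.
apply: leq_trans split1 _; rewrite mul2n -addnn mulnDl addnA leq_add2r.
have -> : (#|B :\: B'| * #|T| = \sum_(y in B :\: B') #|T|)%N by rewrite sum_nat_const.
apply: (@leq_trans (\sum_(x in B') hdeg T B' x + \sum_(y in B :\: B') \sum_(x in B') ((x + y)%R \in T))).
  rewrite exchange_big -big_split /=; apply: leq_sum => x _.
  rewrite /hdeg (_ : [set y in B | _] = [set y in B' | x + y \in T] :|: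
     [set y in B :\: B' | x + y \in T]).
    apply: leq_trans (leq_card_setU _ _) _; rewrite leq_add2l.
    rewrite -sum1_card -[leqRHS]big_mkcondr /=.
    by apply/eq_leq/eq_bigl => y; rewrite !inE.
  apply/setP => y; rewrite !inE -andb_orl; congr andb.
  by case: (boolP (y \in B')) => //= /(subsetP sB).
rewrite leq_add2l; apply: leq_sum => y _; apply: leq_trans (hdeg_le T B' y).
rewrite /hdeg -sum1_card -big_mkcondr /=.
by apply/eq_leq/eq_bigl => x; rewrite !inE addrC.
Qed.

(* The graph joining [x] and [y] when [x + y \in T] has many edges in [A'], so an
   independent set loses a constant proportion of [A'] once the vertices of large
   degree have been queried. *)
Lemma graph_phase T A' T0 j B : #|T| = t -> T \subset T0 -> A' \subset A ->
  {in T, forall v, N <= 2 * E * sum_deg A' v}%N -> B \subset A' ->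
  (#|B| * (8 * E) <= j * t)%N -> sum_containers B T0 (k + j).
Proof.
move=> Tt; have [n] := ubnP #|B|; elim: n B j T0 => // n IH B j T0 ltn TT0 AA' dT BA' jB.
case: (boolP [exists x in B, (t <= 8 * E * hdeg T B x)%N]) => [/exists_inP[x xB hx]|].
  have B0 : (0 < #|B|)%N by rewrite card_gt0; apply/set0Pn; exists x.
  have E0 : (0 < E)%N by move: hx t0; case: (E) => //; rewrite muln0 mul0n leqn0; case: (t).
  case: j jB => [|j] jB.
    by move: jB; rewrite mul0n leqn0 !muln_eq0 !gtn_eqF.
  have cB : #|B| = #|B :\ x|.+1 by rewrite (cardsD1 x) xB.
  rewrite addnS; apply: (sum_containers_query xB).
    rewrite -addnS; apply: IH => //; first by rewrite -ltnS -cB.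
      by apply: subset_trans BA'; rewrite subD1set.
    by apply: leq_trans jB; rewrite leq_mul2r cB leqnSn orbT.
  pose nb := [set y in B | x + y \in T].
  (* If [x] lies in [I], no neighbour [y] does, since [x + y] is in [T] and hence in [I]. At least
     [t / (8 * E)] points disappear, which pays for one unit of [j]. *)
  apply: (@sum_containers_prune (B :\ x :\: nb)); first exact: subsetDl.
    move=> I sI; rewrite subUset sub1set => /andP[xI TI].
    apply/subsetP => y; rewrite !inE => /andP[yI /andP[yx yB]].
    rewrite yx yB /= andbT; apply/negP => h.
    have := sI _ _ xI yI; apply/negP; rewrite negbK.
    by apply: (subsetP (subset_trans TT0 TI)).
  have sub : B :\ x :\: nb \subset B by rewrite (subset_trans (subsetDl _ _)) ?subD1set.
  apply: IH => //.
  - apply: leq_ltn_trans (_ : #|B :\ x| < n)%N; first by rewrite subset_leq_card ?subsetDl.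
    by rewrite -ltnS -cB.
  - by rewrite (subset_trans TT0) ?subsetUr.
  - exact: subset_trans BA'.
  - have cn : (#|B :\ x :\: nb| + #|nb| <= #|B|)%N.
      have nbB : nb \subset B by apply/subsetP => y; rewrite inE => /andP[].
      rewrite -(cardsID nb B) addnC (setIidPr nbB) leq_add2l.
      by rewrite subset_leq_card // setSD // subD1set.
    by move: cn hx jB; rewrite /nb -/(hdeg T B x); nia.
rewrite negb_exists => /forallP small.
apply: (sum_containersW (leq_addr _ _)); apply: next.
have E0 : (0 < E)%N.
  have /card_gt0P[v vT] : (0 < #|T|)%N by rewrite Tt.
  have := dT _ vT; case: (E) => //; rewrite muln0 mul0n leqn0 => /eqP N0.
  suff : (0 < N)%N by rewrite N0.
  by apply/card_gt0P; exists v.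

(* There are at least [t * N / (2 * E)] ordered adjacent pairs in [A'] and at most [t * N / (8 * E)]
   in [B]. The [d] deleted points account for at most [2 * d * t] of them, so [16 * E * d] is at
   least [3 * N], and [d] at least [g]. *)
have lower : (t * N <= 2 * E * \sum_(x in A') hdeg T A' x)%N.
  rewrite sum_hdeg big_distrr /= -Tt -sum_nat_const; exact: leq_sum.
have upper : (8 * E * \sum_(x in B) hdeg T B x <= N * t)%N.
  apply: (@leq_trans (\sum_(x in B) t)).
    rewrite big_distrr /=; apply: leq_sum => x xB; have := small x.
    by rewrite xB /= -ltnNge => /ltnW.
  by rewrite sum_nat_const leq_mul2r max_card orbT.
have := sum_hdeg_sub T BA'; rewrite Tt.
have cA : (#|A' :\: B| + #|B| <= #|A|)%N.
  have := cardsID B A'; rewrite (setIidPr BA') addnC => ->; exact: subset_leq_card.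
move: lower upper cA gN; set a := (\sum_(x in A') _)%N; set b := (\sum_(x in B) _)%N.
set d := #|A' :\: B|; move=> lower upper cA gN' hab.
suff gd : (g <= d)%N by move: cA; lia.
have h1 : (4 * (t * N) <= t * N + 16 * E * d * t)%N by nia.
have h2 : (3 * N <= 16 * E * d)%N by rewrite -(leq_pmul2r t0); nia.
have h3 : (16 * E * g <= 16 * E * d)%N by lia.
by move: h3; rewrite leq_pmul2l // muln_gt0 E0.
Qed.

(** Points of degree at least [N / E] are queried, and those in [I] are collected in [T]. The round
    stops early if [B] has few Schur pairs or has lost [g] points. Once [T] has [t] points, fewer
    than [g] points are lost, so degrees in [B] still exceed [N / (2 * E)] and [graph_phase] applies
    with [8 * E * t] further fingerprint points. *)
Lemma degree_phase T T0 B : B \subset A -> T \subset T0 -> (#|T| <= t)%N ->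
  [disjoint T & B] -> {in T, forall v, N <= E * sum_deg A v}%N ->
  sum_containers B T0 (k + 8 * E * t + (t - #|T|)).
Proof.
have [n] := ubnP #|B|; elim: n B T T0 => // n IH B T T0 ltn BA TT0 Tt dj dT.
case: (ltnP (E * schur_pairs B) (N ^ 2)) => [|big]; first exact: sum_containers_leaf.
case: (leqP (#|B| + g) #|A|) => [h|gB].
  by apply: sum_containersW (next _ h); rewrite -addnA leq_addr.
move: Tt; rewrite leq_eqVlt => /orP[/eqP Tt|Tt].
  rewrite Tt subnn addn0; apply: (@graph_phase T B _ _ B) => //.
    move=> v /dT h; have := sum_deg_setD V2 A B v.
    have : (#|A :\: B| + #|B| = #|A|)%N.
      by have := cardsID B A; rewrite (setIidPr BA) addnC.
    by move: gN h gB; nia.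
  rewrite -[leqRHS]mulnA [leqLHS]mulnC leq_mul2l; apply/orP; right.
  by apply: leq_trans tN; exact: max_card.
have [v vB hv] : exists2 v, v \in B & (N <= E * sum_deg B v)%N.
  apply/exists_inP; apply: contraT; rewrite negb_exists => /forallP H.
  have N0 : (0 < N)%N by rewrite /N; apply/card_gt0P; exists 0.
  have : (E * schur_pairs B <= #|B| * N.-1)%N.
    rewrite /schur_pairs big_distrr /= -sum_nat_const; apply: leq_sum => x xB.
    by have := H x; rewrite xB /= -ltnNge -(prednK N0) ltnS.
  have : (#|B| <= N)%N by exact: max_card.
  by move: big N0; rewrite -mulnn; nia.
have cB : #|B| = #|B :\ v|.+1 by rewrite (cardsD1 v) vB.
have vT : v \notin T by apply/negP => vT; move/pred0P: dj => /(_ v); rewrite /= vT vB.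
rewrite (_ : (_ + (t - #|T|) = (k + 8 * E * t + (t - #|T|.+1)).+1)%N); last by lia.
apply: (sum_containers_query vB).
  rewrite (_ : (_.+1 = k + 8 * E * t + (t - #|T|))%N); last by lia.
  apply: IH => //; first by rewrite -ltnS -cB.
  - by apply: subset_trans BA; rewrite subD1set.
  - exact: ltnW.
  - by rewrite disjoint_sym (disjointWl (subD1set B v)) // disjoint_sym.
have cT : #|v |: T| = #|T|.+1 by rewrite cardsU1 vT.
rewrite -cT; apply: IH; rewrite ?cT //; first by rewrite -ltnS -cB.
- by apply: subset_trans BA; rewrite subD1set.
- by rewrite setUS.
- rewrite disjoint_sym -setI_eq0; apply/eqP/setP => z; rewrite !inE.
  case: (eqVneq z v) => //= zv; apply/negP => /andP[zB zT].
  by move/pred0P: dj => /(_ z); rewrite /= zT zB.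
- move=> x; rewrite !inE => /orP[/eqP->|/dT //].
  by apply: leq_trans hv _; rewrite leq_mul2l sum_deg_sub ?orbT.
Qed.

End Shrink.

(** At most [32 * E] rounds, each removing [g] points, exhaust the group; each adds at most
    [(8 * E + 1) * t] points to the fingerprint. *)
Lemma sum_containers_exist t : (0 < t)%N -> (N <= t * t)%N -> (0 < E)%N -> (16 * E <= N)%N ->
  sum_containers setT set0 (32 * E * ((8 * E + 1) * t)).
Proof.
move=> t0 tN E0 EN; pose g := (N %/ (16 * E))%N.
have gN : (16 * E * g <= N)%N by rewrite mulnC leq_trunc_div.
have gN2 : (N <= 32 * E * g)%N.
  have g1 : (0 < g)%N by rewrite divn_gt0 ?muln_gt0.
  have := ltn_ceil N (_ : 0 < 16 * E)%N; rewrite muln_gt0 E0 -/g => /(_ isT); nia.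
suff H j A T0 : (#|A| <= j * g)%N -> sum_containers A T0 (j * ((8 * E + 1) * t)).
  by apply: H; rewrite cardsT.
elim: j A T0 => [|j IH] A T0 hA.
  have -> : A = set0 by apply/eqP; rewrite -cards_eq0 -leqn0.
  apply: sum_containers_leaf; rewrite /schur_pairs big_set0 muln0 expn_gt0.
  by rewrite (leq_trans _ EN) // muln_gt0.
have := @degree_phase t g (j * ((8 * E + 1) * t)) A t0 tN gN _ set0 T0 A.
rewrite cards0 subn0 => H; apply: (@sum_containersW _ _ _ _ _ (H _ _ _ _ _ _)) => //.
- by nia.
- by move=> B T1 hB; apply: IH; nia.
- exact: sub0set.
- by rewrite -setI_eq0 set0I.
- by move=> v; rewrite inE.
Qed.

End Containers.

(** * Minimal sets that are not 2-colourable *)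

Section TwoColouring.
Variables (V : finZmodType) (V2 : forall x : V, x + x = 0).
Implicit Types (S : {set V}) (gs bs : seq V) (a b t x y z : V).

(** A list, possibly with repetitions, because its length [2 ^ size gs] enters the union bound. *)
Fixpoint span_seq gs : seq V :=
  if gs is g :: gs' then span_seq gs' ++ [seq g + x | x <- span_seq gs'] else [:: 0].

Lemma size_span gs : size (span_seq gs) = (2 ^ size gs)%N.
Proof. by elim: gs => //= g gs IH; rewrite size_cat size_map IH addnn expnS mul2n. Qed.

Lemma span_cons g gs x :
  (x \in span_seq (g :: gs)) = (x \in span_seq gs) || (g + x \in span_seq gs).
Proof.
rewrite /= mem_cat; congr orb; apply/mapP/idP => [[y h ->]|h]; first by rewrite addVK.
by exists (g + x); rewrite ?addVK.
Qed.

Lemma span0 gs : 0 \in span_seq gs.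
Proof. by elim: gs => [|g gs IH] /=; rewrite ?inE // mem_cat IH. Qed.

Arguments span_seq : simpl never.

Lemma spanD gs x y : x \in span_seq gs -> y \in span_seq gs -> x + y \in span_seq gs.
Proof.
elim: gs x y => [|g gs IH] x y; first by rewrite !inE => /eqP-> /eqP->; rewrite addr0.
rewrite !span_cons => /orP[hx|hx] /orP[hy|hy]; have := IH _ _ hx hy.
- by move->.
- by rewrite addrCA => ->; rewrite orbT.
- by rewrite addrA => ->; rewrite orbT.
- by rewrite addrACA V2 add0r => ->.
Qed.

Lemma spanDl gs x y : x \in span_seq gs -> (x + y \in span_seq gs) = (y \in span_seq gs).
Proof.
move=> hx; apply/idP/idP => h; last exact: spanD.
by rewrite -(addVK V2 x y) spanD.
Qed.

Lemma span_consW g gs x : x \in span_seq gs -> x \in span_seq (g :: gs).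
Proof. by rewrite span_cons => ->. Qed.

Lemma span_catr bs gs x : x \in span_seq gs -> x \in span_seq (bs ++ gs).
Proof. by elim: bs => // b bs IH /IH h; rewrite cat_cons span_consW. Qed.

Lemma span_head g gs : g \in span_seq (g :: gs).
Proof. by rewrite span_cons V2 span0 orbT. Qed.

Definition chain_end t bs := foldr +%R t bs.

(* The generators of a chain are listed from the last to the first: [b :: bs]
   prolongs the chain [bs] by the triple [b, e, b + e], [e] being its end. *)
Fixpoint chain t bs : seq V :=
  if bs is b :: bs' then [:: b, b + chain_end t bs' & chain t bs'] else [::].

Lemma size_chain t bs : size (chain t bs) = (size bs).*2.
Proof. by elim: bs => //= b bs ->. Qed.

Lemma chain_end_span t bs gs : t \in span_seq gs -> chain_end t bs \in span_seq (bs ++ gs).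
Proof.
move=> tg; elim: bs => [|b bs IH] //.
by rewrite cat_cons spanD ?span_head ?span_consW.
Qed.

Lemma chain_span t bs gs : t \in span_seq gs -> {subset chain t bs <= span_seq (bs ++ gs)}.
Proof.
move=> tg; elim: bs => [|b bs IH] //= x.
rewrite -cat_cons !inE => /or3P[/eqP->|/eqP->|/IH].
- exact: span_head.
- exact: (@chain_end_span t (b :: bs)).
- exact: span_consW.
Qed.

(** Linear independence over F_2 modulo the span of [gs]. *)
Fixpoint indep gs bs :=
  if bs is b :: bs' then (b \notin span_seq (bs' ++ gs)) && indep gs bs' else true.

(** Each new [b] is outside the span so far, and so is [b + e] as the end [e] is inside it; the two
    differ because [e] stays nonzero. *)
Lemma chain_uniq t bs gs : t \in span_seq gs -> t != 0 -> indep gs bs -> uniq (chain t bs)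
   /\ {in chain t bs, forall x, x \notin span_seq gs}.
Proof.
move=> tg t0; suff H : indep gs bs -> [/\ uniq (chain t bs),
   {in chain t bs, forall x, x \notin span_seq gs} & chain_end t bs != 0].
  by case/H.
elim: bs => [|b bs IH] //= /andP[bn /IH[u h e0]].
have en : b + chain_end t bs \notin span_seq (bs ++ gs).
  by rewrite addrC spanDl // chain_end_span.
split.
- rewrite u !inE !negb_or andbT -{1}[b]addr0 (inj_eq (addrI b)) eq_sym e0 /=.
  apply/andP; split; first by apply: contra bn; exact: chain_span.
  by apply: contra en; exact: chain_span.
- move=> x; rewrite !inE => /or3P[/eqP->|/eqP->|/h //].
    by apply: contra bn; exact: span_catr.
  by apply: contra en; exact: span_catr.
- by apply: contraNneq en => ->; exact: span0.
Qed.

Definition proper2 (f : V -> bool) S := forall x y, x \in S -> y \in S -> x + y \in S ->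
  ~~ ((f x == f y) && (f y == f (x + y))).

Definition two_colourable S := exists f, proper2 f S.

Definition critical S := [/\ ~ two_colourable S, 0 \notin S &
  forall S' : {set V}, S' \proper S -> two_colourable S'].

Lemma critical_sub S : 0 \notin S -> ~ two_colourable S -> exists2 S' : {set V}, S' \subset S & critical S'.
Proof.
have [n] := ubnP #|S|; elim: n S => // n IH S ltn S0 nS.
case: (boolp.pselect (forall S' : {set V}, S' \proper S -> two_colourable S')) => H.
  by exists S.
have [S' [pS' nS']] : exists S' : {set V}, S' \proper S /\ ~ two_colourable S'.
  apply: boolp.contrapT => h; apply: H => S' pS'; apply: boolp.contrapT => h'.
  by apply: h; exists S'.
have [||S'' s1 c1] := IH S' _ _ nS'.
- by apply: leq_trans (proper_card pS') _; rewrite -ltnS.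
- by apply: contra S0; exact: (subsetP (proper_sub pS')).
- by exists S'' => //; apply: subset_trans (proper_sub pS').
Qed.

Lemma triple_distinct S x y : 0 \notin S -> x \in S -> y \in S -> x + y \in S ->
  [/\ x != y, x != x + y & y != x + y].
Proof.
move=> S0 xS yS xyS; split.
- by apply: contraNneq S0 => e; move: xyS; rewrite e V2.
- by rewrite -{1}[x]addr0 (inj_eq (addrI x)) eq_sym; apply: contraNneq S0 => <-.
- by rewrite -{1}[y]add0r (inj_eq (addIr y)) eq_sym; apply: contraNneq S0 => <-.
Qed.

(* Otherwise a proper 2-colouring of [S :\ x] extends to [x]. *)
Lemma critical_deg S x z : critical S -> x \in S ->
  exists2 y, y \in S & [/\ x + y \in S, y != z & x + y != z].
Proof.
move=> [nS S0 min] xS; apply: boolp.contrapT => H.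
have [f pf] := min _ (properD1 xS).
(* All triples through [x] contain [z], so [x] may take the colour opposite to that of [z]. *)
apply: nS; exists (fun v => if v == x then ~~ f z else f v).
have key y : y \in S -> x + y \in S -> (y == z) || (x + y == z).
  move=> yS xyS; apply: contraT; rewrite negb_or => /andP[h1 h2].
  by case: H; exists y.
move=> u v uS vS uvS; have [uv u1 v1] := triple_distinct S0 uS vS uvS.
case: (eqVneq u x) => [ux|ux].
  subst u; rewrite (eq_sym v) (negbTE uv) (eq_sym (x + v)) (negbTE u1).
  case/orP: (key v vS uvS) => /eqP <-; first by case: (f v).
  by case: (f v); case: (f (x + v)).
case: (eqVneq v x) => [vx|vx].
  subst v; rewrite (eq_sym (u + x)) (negbTE v1).
  have := key u uS; rewrite (addrC x) => /(_ uvS) /orP[]/eqP <-; first by case: (f u).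
  by case: (f u); case: (f (u + x)).
case: (eqVneq (u + v) x) => [uvx|uvx].
  have := key u uS; rewrite -uvx (addrC (u + v)) addVK // => /(_ vS) /orP[]/eqP <-.
    by case: (f u); case: (f v).
  by case: (f u); case: (f v).
by apply: pf; rewrite !inE ?ux ?vx ?uvx.
Qed.

(* A longest chain ends with a vertex all of whose triples lie in the span. *)
Lemma chain_stage S gs t y : critical S -> t \in span_seq gs -> t \in S ->
  y \in S -> y \notin span_seq gs -> t + y \in S ->
  exists b bs z, [/\ {subset chain t (b :: bs) <= S}, indep gs (b :: bs), z \in S,
     z \notin span_seq (bs ++ gs) & [/\ z \in span_seq (b :: bs ++ gs), z != b & z != b + chain_end t bs]].
Proof.
move=> cS tg tS yS yn tyS; have S0 : 0 \notin S by case: cS.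
have t0 : t != 0 by apply: contraNneq S0 => <-.
have : exists b bs, {subset chain t (b :: bs) <= S} /\ indep gs (b :: bs).
  exists y, [::]; split; last by rewrite /= yn.
  by move=> x; rewrite !inE addrC => /orP[]/eqP->.
case=> b [bs].
(* Points of a chain are distinct, so its length is bounded and prolongation terminates. *)
have [n] := ubnP (#|V| - size (chain t (b :: bs))); elim: n b bs => // n IH b bs ltn [sS ib].
pose e := b + chain_end t bs.
have eS : e \in S by apply: sS; rewrite !inE eqxx orbT.
(* The chain reached [e] through a triple containing [b]; a second triple at [e] avoids [b]. *)
have [z zS [ezS zb ezb]] := critical_deg b cS eS.
have bn : b \notin span_seq (bs ++ gs) by case/andP: ib.
have en : e \notin span_seq (bs ++ gs) by rewrite /e addrC spanDl // chain_end_span.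
case: (boolP (z \in span_seq (b :: bs ++ gs))) => [zs|zn]; last first.
  apply: (IH z (b :: bs)); last first.
    split; last by rewrite /= zn; exact: ib.
    move=> x; rewrite inE => /predU1P[->//|]; rewrite inE => /predU1P[->|/sS//].
    by rewrite addrC.
  have ib' : indep gs (z :: b :: bs) by rewrite /= zn; exact: ib.
  have [u _] := chain_uniq tg t0 ib'.
  have := card_uniqP u; rewrite size_chain => cu.
  have := max_card (mem (chain t (z :: b :: bs))); rewrite cu.
  move: ltn; rewrite !size_chain /=; move: #|V| (size bs) => N m; clear; lia.
(* One of [z] and [e + z] must lie off the smaller span, because [e] does. *)
case: (boolP (z \in span_seq (bs ++ gs))) => zs'.
  exists b, bs, (e + z); split => //; first by rewrite addrC spanDl.
  split => //; last by rewrite -/e -{2}[e]addr0 (inj_eq (addrI e)); apply: contraNneq S0 => <-.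
  apply: spanD => //; rewrite /e; exact: (@chain_end_span t (b :: bs)).
exists b, bs, z; split => //; split => //.
by apply: contraNneq S0 => h; move: ezS; rewrite h /e V2.
Qed.

(** The vertices stand for three points off a subgroup, the edge labels for the colours of their
    pairwise sums inside it. *)
Lemma nae_triangle (l1 l2 l3 : bool) : exists c : bool * bool * bool,
  [/\ ~~ ((c.1.1 == c.1.2) && (c.1.2 == l3)), ~~ ((c.1.1 == c.2) && (c.2 == l2)) &
      ~~ ((c.1.2 == c.2) && (c.2 == l1))].
Proof.
case: l1; case: l2; case: l3.
- by exists (false, false, false).
- by exists (false, true, false).
- by exists (true, false, false).
- by exists (true, false, true).
- by exists (false, true, false).
- by exists (true, true, false).
- by exists (true, false, true).
- by exists (true, true, true).
Qed.

(* A colouring of the trace of [S] on the subgroup, given by criticality, extends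
   to the at most three points of the other coset. *)
Lemma critical_not_coset S gs a b z : critical S -> uniq [:: a; b; z] ->
  (exists2 t, t \in S & t \notin span_seq gs) ->
  {in S, forall x, x \notin span_seq gs -> x \in [:: a; b; z]} ->
  {subset S <= span_seq (a :: gs)} -> False.
Proof.
move=> [nS S0 min] uq [t tS tn] three sub.
have [f pf] : two_colourable [set x in S | x \in span_seq gs].
  apply: min; apply/properP; split; first by apply/subsetP => x; rewrite inE => /andP[].
  by exists t => //; rewrite inE (negbTE tn) andbF.
have [[[ca cb] cz] /= [h3 h2 h1]] := nae_triangle (f (b + z)) (f (a + z)) (f (a + b)).
apply: nS.
pose g x := if x \in span_seq gs then f x else if x == a then ca else if x == b then cb else cz.
(* Two points of the other coset sum into the subgroup, so a triple leaving the subgroup has exactly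
   two points in that coset. *)
have par x y : x \in S -> y \in S -> x \notin span_seq gs -> y \notin span_seq gs ->
    x + y \in span_seq gs.
  move=> xS yS xn yn; have := sub _ xS; have := sub _ yS.
  rewrite !span_cons (negbTE xn) (negbTE yn) /= => hy hx.
  by have := spanD hx hy; rewrite addrACA V2 add0r.
have main x y : x \in S -> y \in S -> x + y \in S -> x \notin span_seq gs ->
   y \notin span_seq gs -> ~~ ((g x == g y) && (g y == g (x + y))).
  move=> xS yS xyS xn yn; have xys := par _ _ xS yS xn yn.
  have [xy _ _] := triple_distinct S0 xS yS xyS.
  move: xn yn xys xy; rewrite /g => xn yn -> xy; rewrite (negbTE xn) (negbTE yn).
  have := three _ xS xn; have := three _ yS yn; move: xy h1 h2 h3; rewrite !inE.
  have := uq; rewrite /= !inE !negb_or andbT => /andP[/andP[ab az] bz].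
  have [ba za zb] : [/\ b == a = false, z == a = false & z == b = false].
    by rewrite !(eq_sym b) !(eq_sym z) (negbTE ab) (negbTE az) (negbTE bz).
  clear g; by move=> xy h1 h2 h3 /or3P[]/eqP ye /or3P[]/eqP xe; move: xy h1 h2 h3;
    rewrite xe ye ?eqxx ?ba ?za ?zb // ?(addrC b a) ?(addrC z);
    case: ca; case: cb; case: cz => //; rewrite ?eqxx.
exists g => x y xS yS xyS.
case: (boolP (x \in span_seq gs)) => xs; case: (boolP (y \in span_seq gs)) => ys.
- have xys := spanD xs ys; rewrite /g xs ys xys; apply: pf; rewrite inE ?xS ?yS ?xyS //.
- have h : x + y \notin span_seq gs by rewrite spanDl.
  have := main _ _ yS xyS; rewrite (addrC x) addVK // => /(_ xS ys).
  rewrite addrC => /(_ h); apply: contra => /andP[/eqP-> /eqP->].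
  by rewrite eqxx.
- have h : x + y \notin span_seq gs by rewrite addrC spanDl.
  have := main _ _ xS xyS; rewrite addVK // => /(_ yS xs h).
  by apply: contra => /andP[/eqP-> /eqP->]; rewrite eqxx.
- exact: main.
Qed.

(* Two chains with an extra point for each: [k] generators, [2k + 1] points. *)
Definition dense_points a bs1 w t bs2 z :=
  z :: chain t bs2 ++ w :: chain a bs1 ++ [:: a].

Lemma size_dense_points a bs1 w t bs2 z :
  size (dense_points a bs1 w t bs2 z) = (2 * (size bs1 + size bs2 + 1) + 1)%N.
Proof. by rewrite /= size_cat /= size_cat !size_chain /=; lia. Qed.

(** In a critical subset, a chain from [a] closing at [w] gives [2k] points in the span of [k]
    generators, one too few. Either the span contains a further point [z], or the set leaves the
    span, and a second chain, starting at some [t] in the span and closing at [z], supplies the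
    missing point. *)
Lemma dense_points_exist (U : {set V}) : 0 \notin U -> ~ two_colourable U ->
  exists a bs1 w t bs2 z, [/\ w \in span_seq (bs1 ++ [:: a]), t \in span_seq (bs1 ++ [:: a]),
    z \in span_seq (bs2 ++ bs1 ++ [:: a]), uniq (dense_points a bs1 w t bs2 z) &
    {subset dense_points a bs1 w t bs2 z <= U}].
Proof.
move=> S0' nS'; have [S sub cS] := critical_sub S0' nS'.
suff [a [bs1 [w [t [bs2 [z [h1 h2 h3 h4 h5]]]]]]] :
  exists a bs1 w t bs2 z, [/\ w \in span_seq (bs1 ++ [:: a]), t \in span_seq (bs1 ++ [:: a]),
    z \in span_seq (bs2 ++ bs1 ++ [:: a]), uniq (dense_points a bs1 w t bs2 z) &
    {subset dense_points a bs1 w t bs2 z <= S}].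
  exists a, bs1, w, t, bs2, z; split => // x /h5; exact: (subsetP sub).
have [nS S0 min] := cS.
have [a aS] : exists a, a \in S.
  apply/set0Pn; apply/eqP => Se; apply: nS; exists xpredT => x y; by rewrite Se inE.
have a0 : a != 0 by apply: contraNneq S0 => <-.
have sa : span_seq [:: a] = [:: 0; a] by rewrite /span_seq /= addr0.
have ag : a \in span_seq [:: a] by rewrite sa !inE eqxx orbT.
have [y yS [ayS ya _]] := critical_deg a cS aS.
have yn : y \notin span_seq [:: a].
  by rewrite sa !inE negb_or ya andbT; apply: contraNneq S0 => <-.
have [b [bs [w [cS1 ind wS wn [ws wb we]]]]] := chain_stage cS ag aS yS yn ayS.
have [u1 c1] := chain_uniq ag a0 ind.
have wnc : w \notin chain a (b :: bs) ++ [:: a].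
  rewrite mem_cat /= !inE (negbTE wb) (negbTE we) /= negb_or.
  apply/andP; split; first by apply: contra wn; exact: chain_span.
  by apply: contraNneq wn => ->; exact: span_catr.
have anc : a \notin chain a (b :: bs) by apply/negP => /c1; rewrite ag.
have uT1 : uniq (w :: chain a (b :: bs) ++ [:: a]).
  by rewrite cons_uniq wnc cats1 rcons_uniq anc u1.
have T1S : {subset w :: chain a (b :: bs) ++ [:: a] <= S}.
  by move=> x; rewrite inE mem_cat mem_seq1 => /or3P[/eqP->|/cS1|/eqP->].
have T1s : {subset w :: chain a (b :: bs) ++ [:: a] <= span_seq ((b :: bs) ++ [:: a])}.
  move=> x; rewrite inE mem_cat mem_seq1 => /or3P[/eqP->//|xc|/eqP->]; last exact: span_catr.
  exact: chain_span xc.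
case: (boolP [exists z in S, (z \in span_seq ((b :: bs) ++ [:: a])) &&
    (z \notin w :: chain a (b :: bs) ++ [:: a])]) => [/exists_inP[z zS /andP[zs zn]]|].
  (* The second chain is empty and [0] is a placeholder for its start. *)
  exists a, (b :: bs), w, 0, [::], z; split => //; first exact: span0.
    by rewrite /dense_points cat0s cons_uniq zn.
  by move=> x; rewrite /dense_points cat0s inE => /predU1P[->|/T1S].
rewrite negb_exists => /forallP noz.
have inT1 x : x \in S -> x \in span_seq ((b :: bs) ++ [:: a]) ->
    x \in w :: chain a (b :: bs) ++ [:: a].
  by move=> xS xs; have := noz x; rewrite xS xs /= negbK.
have bn : b \notin span_seq (bs ++ [:: a]) by case/andP: ind.
have bS : b \in S by apply: cS1; rewrite inE eqxx.
(* If the whole set lay in the span, its only points off the span of [bs ++ [:: a]] would be [b],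
   the chain end and [w], against [critical_not_coset]. *)
have [t' t'S t'n] : exists2 t', t' \in S & t' \notin span_seq ((b :: bs) ++ [:: a]).
  apply: boolp.contrapT => H.
  apply: (@critical_not_coset S (bs ++ [:: a]) b (b + chain_end a bs) w) => //.
  - rewrite /= !inE !negb_or !(eq_sym _ w) wb we !andbT.
    by move: u1; rewrite /= inE negb_or => /andP[/andP[]].
  - by exists b.
  - move=> x xS xn; have : x \in span_seq ((b :: bs) ++ [:: a]).
      by apply: contraT => xn'; case: H; exists x.
    move/(inT1 _ xS); rewrite inE mem_cat /= !inE.
    case/predU1P => [->|]; first by rewrite eqxx !orbT.
    case/orP; last by move/eqP => xa; move: xn; rewrite xa span_catr.
    case/or3P => [->|->|xc] //; first by rewrite orbT.
    by move: xn; rewrite (chain_span ag xc).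
  - by move=> x xS; apply: contraT => xn'; case: H; exists x.
(* Otherwise no triple crosses between [W] and its complement, and colourings of the two proper
   parts glue together. *)
have [t [y' [tS ts y'S [y'n ty'S]]]] : exists t y', [/\ t \in S,
   t \in span_seq ((b :: bs) ++ [:: a]), y' \in S &
   y' \notin span_seq ((b :: bs) ++ [:: a]) /\ t + y' \in S].
  apply: boolp.contrapT => H; apply: nS.
  set W := span_seq ((b :: bs) ++ [:: a]) in t'n H *.
  have [f pf] : two_colourable [set x in S | x \in W].
    apply: min; apply/properP; split; first by apply/subsetP => x; rewrite inE => /andP[].
    by exists t' => //; rewrite inE (negbTE t'n) andbF.
  have [g pg] : two_colourable [set x in S | x \notin W].
    apply: min; apply/properP; split; first by apply/subsetP => x; rewrite inE => /andP[].
    exists a => //; rewrite inE aS /= negbK; exact: span_catr.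
  exists (fun x => if x \in W then f x else g x) => u v uS vS uvS.
  case: (boolP (u \in W)) => uW.
    case: (boolP (v \in W)) => vW; last by case: H; exists u, v.
    by rewrite (spanD uW vW); apply: pf; rewrite inE ?uS ?vS ?uvS ?uW ?vW ?spanD.
  case: (boolP (v \in W)) => vW; first by case: H; exists v, u; rewrite addrC.
  case: (boolP (u + v \in W)) => uvW.
    by case: H; exists (u + v), u; rewrite (addrC u) -addrA V2 addr0 addrC.
  by apply: pg; rewrite inE ?uS ?vS ?uvS ?uW ?vW.
have [b2 [bs2 [z [cS2 ind2 zS zn [zs zb ze]]]]] := chain_stage cS ts tS y'S y'n ty'S.
have t0 : t != 0 by apply: contraNneq S0 => <-.
have [u2 c2] := chain_uniq ts t0 ind2.
exists a, (b :: bs), w, t, (b2 :: bs2), z; split => //.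
- rewrite /dense_points cons_uniq cat_uniq u2 uT1 andbT andTb; apply/andP; split.
    rewrite mem_cat negb_or; apply/andP; split.
      rewrite /= !inE (negbTE zb) (negbTE ze) /=; apply: contra zn; exact: chain_span.
    by apply: contra zn => /T1s; exact: span_catr.
  by apply/hasPn => x /T1s h; apply/negP => /c2; rewrite h.
- move=> x; rewrite /dense_points inE mem_cat => /or3P[/eqP->|/cS2|/T1S] //.
Qed.

End TwoColouring.

(** * Probability estimates for the binomial random subset *)

Section RandomSubset.
Variables (R : realType) (T : finType) (p : R).
Hypothesis p01 : 0 <= p <= 1.
Implicit Types (E F : pred {set T}) (S X Y : {set T}).

Let wt S : R := p ^+ #|S| * (1 - p) ^+ #|~: S|.

Let wt_ge0 S : 0 <= wt S.
Proof.
by case/andP: p01 => p0 p1; rewrite mulr_ge0 ?exprn_ge0 // subr_ge0.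
Qed.

Lemma prob_ge0 E : 0 <= prob_random_subset p E.
Proof. by apply: sumr_ge0 => S _; exact: wt_ge0. Qed.

Lemma prob_sub E F : subpred E F -> prob_random_subset p E <= prob_random_subset p F.
Proof.
move=> EF; rewrite /prob_random_subset [leLHS]big_mkcond [leRHS]big_mkcond /=.
apply: ler_sum => S _; case: ifP => [/EF->//|_]; case: ifP => // _; exact: wt_ge0.
Qed.

Lemma prob_has (I : Type) (l : seq I) (F : I -> pred {set T}) :
  prob_random_subset p (fun S => has (fun i => F i S) l) <=
  \sum_(i <- l) prob_random_subset p (F i).
Proof.
rewrite /prob_random_subset; under [leRHS]eq_bigr do rewrite big_mkcond.
rewrite exchange_big /= big_mkcond /=; apply: ler_sum => S _.
have h0 l' : 0 <= \sum_(i <- l') (if F i S then wt S else 0).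
  by apply: sumr_ge0 => i _; case: ifP => // _; exact: wt_ge0.
elim: l => [|i l IH]; first by rewrite big_nil.
by rewrite big_cons /=; case: (F i S) => /=; rewrite ?lerDl ?add0r.
Qed.

Lemma probU E F :
  prob_random_subset p (predU E F) <= prob_random_subset p E + prob_random_subset p F.
Proof.
have := prob_has [:: true; false] (fun b : bool => if b then E else F).
rewrite big_cons big_seq1; apply: le_trans; apply: prob_sub => S /=.
by rewrite orbF.
Qed.

Lemma prob_in_out X Y : [disjoint X & Y] ->
  prob_random_subset p (fun S => (X \subset S) && [disjoint S & Y]) =
  p ^+ #|X| * (1 - p) ^+ #|Y|.
Proof.
move=> dXY.
(* [F i] and [G i] are the weights of keeping and dropping [i], set to 0 where forbidden; expanding
   the product sums over all subsets. *)
pose F i := if i \in Y then 0 else p; pose G i := if i \in X then 0 else 1 - p.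
have -> : p ^+ #|X| * (1 - p) ^+ #|Y| = \prod_i (F i + G i).
  rewrite (bigID (mem X)) /= (bigID (mem Y) [pred i | i \notin X]) /=.
  rewrite [X in _ * (_ * X)]big1 ?mulr1; last first.
    by move=> i /andP[/negbTE iX /negbTE iY]; rewrite /F /G iX iY addrC subrK.
  congr (_ * _).
    rewrite -prodr_const; apply: eq_bigr => i iX; rewrite /F /G iX addr0.
    by move/pred0P: dXY => /(_ i) /=; rewrite iX /= => ->.
  rewrite -prodr_const; apply: eq_big => [i|i iY].
    by move/pred0P: dXY => /(_ i) /=; case: (i \in X); case: (i \in Y).
  move/pred0P: dXY => /(_ i) /=; rewrite /F /G iY andbT => ->; by rewrite add0r.
rewrite bigA_distr /prob_random_subset big_mkcond /=; apply: eq_bigr => S _.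
case: ifP => [/andP[/subsetP XS /pred0P dSY]|].
  rewrite (bigID (mem S)) /=; congr (_ * _).
    rewrite -prodr_const; apply: eq_bigr => i iS; rewrite iS /F.
    by have := dSY i; rewrite /= iS /= => ->.
  rewrite -prodr_const; apply: eq_big => [i|i]; first by rewrite inE.
  rewrite inE => iS; rewrite (negbTE iS) /G; case: ifP => // /XS.
  by rewrite (negbTE iS).
move/negbT; rewrite negb_and => /orP[/subsetPn[i iX iS]|].
  by rewrite (bigD1 i) //= (negbTE iS) /G iX mul0r.
move/pred0Pn => [i /= /andP[iS iY]].
by rewrite (bigD1 i) //= iS /F iY mul0r.
Qed.

(** The total mass is 1, by [prob_in_out] for two empty sets. *)
Lemma prob_predC E : prob_random_subset p E = 1 - prob_random_subset p (predC E).
Proof.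
have := @prob_in_out set0 set0; rewrite -setI_eq0 set0I eqxx => /(_ isT).
rewrite !cards0 !expr0 mulr1 => <-; rewrite /prob_random_subset.
rewrite [X in _ = X - _](eq_bigl predT) => [|S]; last first.
  by rewrite sub0set /= -setI_eq0 setI0 eqxx.
by rewrite [X in _ = X - _](bigID E) /= addrK.
Qed.

Section Fibres.
Variables (V : finType) (pi : T -> V) (f : nat).
Hypothesis fibre : forall v, #|[set x | pi x == v]| = f.

(** Union bound over one preimage for each point of [l]; these are disjoint from the [f * #|D|]
    preimages of [D] to be avoided. *)
Lemma prob_fibres (l : seq V) (D : {set V}) : uniq l -> {in l, forall v, v \notin D} ->
  prob_random_subset p (fun S => all (mem (pi @: S)) l && [disjoint pi @: S & D]) <=
  (f%:R * p) ^+ size l * (1 - p) ^+ (f * #|D|).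
Proof.
move=> ul lD; case/andP: (p01) => p0 p1.
pose Y := pi @^-1: D.
have cY : #|Y| = (f * #|D|)%N.
  rewrite -sum1_card (partition_big pi (mem D)) /=; last by move=> x; rewrite inE.
  rewrite mulnC -sum_nat_const; apply: eq_bigr => v vD.
  rewrite -(fibre v) -sum1_card; apply: eq_bigl => x; rewrite !inE.
  by case: eqP => [->|]; rewrite ?vD ?andbF ?andbT.
(* Generalised for the induction: [X] holds the preimages chosen so far. *)
suff H X : [disjoint X & Y] -> {in l, forall v, v \notin pi @: X} ->
    prob_random_subset p (fun S => [&& X \subset S, all (mem (pi @: S)) l & [disjoint S & Y]])
      <= f%:R ^+ size l * (p ^+ (#|X| + size l) * (1 - p) ^+ #|Y|).
  have := H set0; rewrite cards0 add0n cY mulrA -exprMn => H0.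
  apply: le_trans (H0 _ _).
  - apply: prob_sub => S /andP[-> dj]; rewrite sub0set /= -setI_eq0.
    apply/eqP/setP => x; rewrite !inE; apply/negP => /andP[xS xD].
    by move/pred0P: dj => /(_ (pi x)) /=; rewrite xD imset_f.
  - by rewrite -setI_eq0 set0I.
  - by move=> v _; rewrite imset0 inE.
elim: l ul lD X => [|v l IH] /= ul lD X dXY lX.
  rewrite mul1r addn0 -prob_in_out //; apply: prob_sub => S; by rewrite andbT.
case/andP: ul => vl ul.
pose fv := [set x | pi x == v].
apply: (@le_trans _ _ (\sum_(x <- enum fv) prob_random_subset p
   (fun S => [&& (x |: X) \subset S, all (mem (pi @: S)) l & [disjoint S & Y]]))).
  apply: le_trans (prob_has _ _); apply: prob_sub => S.
  case/and3P => XS /andP[/imsetP[x xS vx] al] dj; apply/hasP; exists x.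
    by rewrite mem_enum inE vx.
  by rewrite /= al dj subUset sub1set xS XS.
rewrite big_enum /=.
apply: (@le_trans _ _ (\sum_(x in fv) f%:R ^+ size l *
    (p ^+ (#|X| + (size l).+1) * (1 - p) ^+ #|Y|))); last first.
  by rewrite sumr_const fibre -[leLHS]mulr_natl mulrA -exprS.
apply: ler_sum => x; rewrite inE => /eqP xv.
have xX : x \notin X.
  apply/negP => xX; have := lX v; rewrite inE eqxx => /(_ isT); rewrite -xv imset_f //.
rewrite (_ : (#|X| + (size l).+1 = #|x |: X| + size l)%N); last by rewrite cardsU1 xX addnS.
apply: IH => //.
- by move=> u ul'; apply: lD; rewrite inE ul' orbT.
- rewrite -setI_eq0; apply/eqP/setP => y; rewrite !inE.
  case: (eqVneq y x) => [->|yx] /=.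
    by rewrite xv; apply/negbTE/lD; rewrite inE eqxx.
  by move/pred0P: dXY => /(_ y) /=; rewrite !inE.
- move=> u ul'; apply/negP => /imsetP[y]; rewrite !inE => /orP[/eqP->|yX] uE.
    by move: vl; rewrite -xv -uE ul'.
  by have := lX u; rewrite inE ul' orbT uE imset_f // => /(_ isT).
Qed.

End Fibres.
End RandomSubset.

(** * Transfer to Schur triples and the two probability bounds *)

Section Reduction.
Variables (G V : finZmodType) (pi : {additive G -> V}).
Hypothesis V2 : forall x : V, x + x = 0.
Hypothesis pi_eq0 : forall x, (pi x == 0) = (x *+ 2 == 0).
Implicit Types (S : {set G}).

Let i0 : 'I_3 := ord0.
Let i1 : 'I_3 := lift ord0 ord0.
Let i2 : 'I_3 := lift ord0 (lift ord0 ord0).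

Let ord3P (P : 'I_3 -> Prop) : P i0 -> P i1 -> P i2 -> forall i, P i.
Proof.
move=> P0 P1 P2 [[|[|[|j]]] h] //.
- by rewrite (_ : Ordinal h = i0) //; apply: val_inj.
- by rewrite (_ : Ordinal h = i1) //; apply: val_inj.
- by rewrite (_ : Ordinal h = i2) //; apply: val_inj.
Qed.

(** The equation doubles [x i0 + x i1 - x i2], and doubling has the same kernel as [pi]. *)
Lemma is_solution_pi (x : 'I_3 -> G) :
  is_solution A22m2 x = (pi (x i0) + pi (x i1) == pi (x i2)).
Proof.
rewrite /is_solution; transitivity (\sum_(j < 3) x j *~ A22m2 ord0 j == 0).
  apply/forallP/idP => [/(_ ord0) //|h i]; by rewrite ord1.
rewrite !big_ord_recl big_ord0 !mxE /= addr0 -/i0 -/i1 -/i2.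
have -> : x i0 *~ 2 + (x i1 *~ 2 + x i2 *~ (-2)) = (x i0 + x i1 - x i2) *+ 2.
  by rewrite mulrNz -!pmulrn mulrnBl mulrnDl addrA.
by rewrite -pi_eq0 raddfB raddfD /= subr_eq0.
Qed.

(** Pull the 2-colouring back along [pi], using colours 0 and 1 of the [r] available. *)
Lemma two_colourable_not_rado r S : (2 <= r)%N -> 0 \notin pi @: S ->
  two_colourable (pi @: S) -> ~~ is_rado A22m2 r S.
Proof.
move=> r2 S0 [f pf]; have r0 : (0 < r)%N by apply: ltnW.
apply/negP => /forallP/(_ [ffun s => if f (pi (val s)) then Ordinal r0 else Ordinal r2]).
case/existsP => x /and3P[_]; rewrite is_solution_pi => /eqP sol /forallP mono.
have inS j : pi (val (x j)) \in pi @: S by rewrite imset_f // (valP (x j)).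
have eqf i j : f (pi (val (x i))) = f (pi (val (x j))).
  by have /forallP/(_ j) := mono i; rewrite !ffunE; do 2 case: (f _).
have := pf _ _ (inS i0) (inS i1); rewrite sol => /(_ (inS i2)).
by rewrite (eqf i0 i1) (eqf i1 i2) eqxx.
Qed.

(** Colour [v] by one chosen preimage in [S], with colour 0 as default. A Schur triple of nonzero
    points in one class lifts to a monochromatic solution, whose entries differ since their images
    do. *)
Lemma not_rado_colouring r S : (0 < r)%N -> ~~ is_rado A22m2 r S ->
  exists col : V -> 'I_r,
    forall i, sum_free [set v in pi @: S | (col v == i) && (v != 0)].
Proof.
move=> r0; rewrite negb_forall => /existsP[chi]; rewrite negb_exists => /forallP nx.
pose pk v := [pick s : {s : G | s \in S} | pi (val s) == v].
exists (fun v => if pk v is Some s then chi s else Ordinal r0).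
move=> i u v; rewrite !inE; set c := fun v => if pk v is Some s then chi s else Ordinal r0.
rewrite -/(c u) -/(c v) -/(c (u + v)) => /and3P[uS /eqP cu u0] /and3P[vS /eqP cv v0].
apply/negP => /and3P[uvS /eqP cuv uv0].
have pick w : w \in pi @: S -> exists2 s : {s : G | s \in S}, pi (val s) = w & chi s = c w.
  case/imsetP => y yS wy; rewrite /c /pk; case: pickP => [s /eqP <-|]; first by exists s.
  by move/(_ (exist _ y yS)); rewrite /= wy eqxx.
have [su hu cu'] := pick _ uS; have [sv hv cv'] := pick _ vS.
have [sw hw cw'] := pick _ uvS.
have := nx [ffun j : 'I_3 => if j == i0 then su else if j == i1 then sv else sw].
set x := [ffun j => _]; have x0 : x i0 = su by rewrite ffunE.
have x1 : x i1 = sv by rewrite ffunE.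
have x2 : x i2 = sw by rewrite ffunE.
have neq (s1 s2 : {s : G | s \in S}) : pi (val s1) != pi (val s2) -> s1 <> s2.
  by move=> h e; move: h; rewrite e eqxx.
have n01 : su <> sv.
  by apply: neq; rewrite hu hv; apply: contraNneq uv0 => ->; rewrite V2.
have n02 : su <> sw by apply: neq; rewrite hu hw -{1}[u]addr0 (inj_eq (addrI u)) eq_sym.
have n12 : sv <> sw by apply: neq; rewrite hv hw -{1}[v]add0r (inj_eq (addIr v)) eq_sym.
move/negP; apply; apply/and3P; split.
- apply/injectiveP; do 2 apply: ord3P; rewrite ?x0 ?x1 ?x2 // => e; congruence.
- by rewrite is_solution_pi x0 x1 x2 hu hv hw.
- apply/forallP => a; apply/forallP => b; apply/eqP; move: a b.
  by do 2 apply: ord3P; rewrite ?x0 ?x1 ?x2 ?cu' ?cv' ?cw' ?cu ?cv ?cuv.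
Qed.

Variables (R : realType) (p : R) (f : nat).
Hypothesis p01 : 0 <= p <= 1.
Hypothesis fibre : forall v, #|[set x | pi x == v]| = f.
Let q := f%:R * p.
Let N := #|V|.
Let p0 : 0 <= p. Proof. by case/andP: p01. Qed.
Let p1 : 0 <= 1 - p. Proof. by rewrite subr_ge0; case/andP: p01. Qed.
Let q0 : 0 <= q. Proof. by rewrite mulr_ge0. Qed.

Let prob_points (l : seq V) : uniq l ->
  prob_random_subset p (fun S : {set G} => all (mem (pi @: S)) l) <= q ^+ size l.
Proof.
move=> ul; have := prob_fibres p01 fibre ul (D := set0).
rewrite cards0 muln0 expr0 mulr1 => h; apply: le_trans (h _); last by move=> v; rewrite inE.
by apply: (prob_sub p01) => S ->; rewrite -setI_eq0 setI0 eqxx.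
Qed.

Let prob_has_le (I : eqType) (l : seq I) (F : I -> pred {set G}) (c : R) :
  {in l, forall i, prob_random_subset p (F i) <= c} ->
  prob_random_subset p (fun S => has (fun i => F i S) l) <= (size l)%:R * c.
Proof.
move=> h; apply: le_trans (prob_has p01 _ _) _.
rewrite -sum1_size natr_sum mulr_suml big_seq [leRHS]big_seq.
by apply: ler_sum => i il; rewrite mul1r h.
Qed.

Let dense_event (m n : nat) (S : {set G}) :=
  has (fun a => has (fun bs1 : m.-tuple V => has (fun bs2 : n.-tuple V =>
  has (fun w => has (fun t => has (fun z =>
    uniq (dense_points a bs1 w t bs2 z) && all (mem (pi @: S)) (dense_points a bs1 w t bs2 z))
   (span_seq (bs2 ++ bs1 ++ [:: a]))) (span_seq (bs1 ++ [:: a]))) (span_seq (bs1 ++ [:: a])))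
   (enum {: n.-tuple V})) (enum {: m.-tuple V})) (enum V).

(** There are [N ^ k] choices of generators and at most [8 ^ k] of [w], [t], [z]; the [2k + 1]
    distinct points are all hit with probability at most [q ^+ (2 * k + 1)]. *)
Let prob_dense_event m n : 8 * N%:R * q ^+ 2 <= 2^-1 ->
  prob_random_subset p (dense_event m n) <= q / 2 * (2^-1 ^+ m * 2^-1 ^+ n).
Proof.
move=> hq; set k := (m + n + 1)%N.
pose c1 : R := (2 ^ (n + (m + 1)))%:R * q ^+ (2 * k + 1).
apply: (@le_trans _ _ (N%:R * ((N ^ m)%:R * ((N ^ n)%:R *
     ((2 ^ (m + 1))%:R * ((2 ^ (m + 1))%:R * c1)))))).
  have -> : N = size (enum V) by rewrite -cardE.
  apply: prob_has_le => a _.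
  have -> : (size (enum V) ^ m)%N = size (enum {: m.-tuple V}) by rewrite -!cardE card_tuple.
  apply: prob_has_le => bs1 _.
  have -> : (size (enum V) ^ n)%N = size (enum {: n.-tuple V}) by rewrite -!cardE card_tuple.
  apply: prob_has_le => bs2 _.
  have s1 : (2 ^ (m + 1))%N = size (span_seq (bs1 ++ [:: a])).
    by rewrite size_span size_cat size_tuple.
  rewrite s1; apply: prob_has_le => w _; apply: prob_has_le => t _.
  have s2 : (2 ^ (n + (m + 1)))%N = size (span_seq (bs2 ++ bs1 ++ [:: a])).
    by rewrite size_span !size_cat !size_tuple.
  rewrite /c1 s2; apply: prob_has_le => z _.
  case: (boolP (uniq (dense_points a bs1 w t bs2 z))) => u /=.
    rewrite /k -[X in (X + _ + _)%N](size_tuple bs1) -[X in (_ + X + _)%N](size_tuple bs2).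
    rewrite -(size_dense_points a bs1 w t bs2 z).
    by apply: le_trans (prob_points u); apply: (prob_sub p01).
  by rewrite /prob_random_subset big_pred0 // exprn_ge0.
rewrite [leLHS](_ : _ =
    (N ^ k * 2 ^ ((m + 1) + (m + 1) + (n + (m + 1))))%:R * q ^+ (2 * k + 1)); last first.
  by rewrite /c1 /k natrM !natrX !exprD !expr1; ring.
apply: (@le_trans _ _ ((N ^ k * 8 ^ k)%:R * q ^+ (2 * k + 1))).
  rewrite ler_wpM2r ?exprn_ge0 // ler_nat leq_mul2l (_ : 8 = 2 ^ 3)%N // -expnM.
  by rewrite leq_pexp2l ?orbT // /k; lia.
have -> : (N ^ k * 8 ^ k)%:R * q ^+ (2 * k + 1) = q * (8 * N%:R * q ^+ 2) ^+ k.
  by rewrite natrM !natrX exprD exprM expr1 !exprMn; ring.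
have -> : q / 2 * (2^-1 ^+ m * 2^-1 ^+ n) = q * 2^-1 ^+ k.
  by rewrite /k !exprD expr1; ring.
by rewrite ler_wpM2l // lerXn2r // ?nnegrE ?invr_ge0 // !mulr_ge0 // exprn_ge0.
Qed.

Let sum_half m : \sum_(0 <= i < m) (2^-1 : R) ^+ i <= 2.
Proof.
suff -> : \sum_(0 <= i < m) (2^-1 : R) ^+ i = 2 - 2 * 2^-1 ^+ m.
  by rewrite lerBlDr lerDl mulr_ge0 // exprn_ge0 // invr_ge0.
elim: m => [|m IH]; first by rewrite big_geq // expr0; ring.
by rewrite big_nat_recr //= IH exprS; field.
Qed.

(** The image contains 0 with probability at most [q]; the dense events contribute at most [2 * q],
    by two geometric sums over the chain lengths. *)
Lemma prob_rado_le r : (2 <= r)%N -> 8 * N%:R * q ^+ 2 <= 2^-1 ->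
  prob_random_subset p (fun S : {set G} => is_rado A22m2 r S) <= 3 * q.
Proof.
move=> r2 hq.
pose E1 (S : {set G}) := all (mem (pi @: S)) [:: 0].
pose E2 (S : {set G}) := has (fun m => has (fun n => dense_event m n S) (index_iota 0 N.+1)) (index_iota 0 N.+1).
apply: (@le_trans _ _ (prob_random_subset p (predU E1 E2))).
  apply: (prob_sub p01) => S radoS; rewrite inE; case: (boolP (E1 S)) => //= n0.
  have S0 : 0 \notin pi @: S by move: n0; rewrite /E1 /= andbT.
  have nc : ~ two_colourable (pi @: S).
    by move=> h; have := two_colourable_not_rado r2 S0 h; rewrite radoS.
  have [a [bs1 [w [t [bs2 [z [hw ht hz u sub]]]]]]] := dense_points_exist V2 S0 nc.
  (* Distinctness of the points bounds the chain lengths by [N], so finitely many events suffice. *)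
  have sz : (size (dense_points a bs1 w t bs2 z) <= N)%N.
    by rewrite -(card_uniqP u) max_card.
  have aux x y m : (2 * (x + y + 1) + 1 <= m -> x < m.+1 /\ y < m.+1)%N by clear; lia.
  move: sz; rewrite size_dense_points => /aux[sz1 sz2].
  apply/hasP; exists (size bs1); first by rewrite mem_index_iota.
  apply/hasP; exists (size bs2); first by rewrite mem_index_iota.
  apply/hasP; exists a; first by rewrite mem_enum.
  apply/hasP; exists (in_tuple bs1); first by rewrite mem_enum.
  apply/hasP; exists (in_tuple bs2); first by rewrite mem_enum.
  apply/hasP; exists w => //; apply/hasP; exists t => //; apply/hasP; exists z => //.
  by rewrite u andTb; apply/allP => v vl; exact: (sub v).
apply: le_trans (probU p01 _ _) _.
have h1 : prob_random_subset p E1 <= q by have := prob_points (l := [:: 0]); rewrite expr1; exact.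
have h2 : prob_random_subset p E2 <= q / 2 * (2 * 2).
  apply: le_trans (prob_has p01 _ _) _.
  apply: (@le_trans _ _ (\sum_(0 <= m < N.+1) \sum_(0 <= n < N.+1) q / 2 * (2^-1 ^+ m * 2^-1 ^+ n))).
    apply: ler_sum => m _; apply: le_trans (prob_has p01 _ _) _.
    by apply: ler_sum => n _; exact: prob_dense_event.
  under eq_bigr do rewrite -mulr_sumr -mulr_sumr.
  rewrite -mulr_sumr -mulr_suml ler_wpM2l ?divr_ge0 //.
  by rewrite ler_pM ?sum_half //; apply: sumr_ge0 => i _; rewrite exprn_ge0 // invr_ge0.
by move: h1 h2; lra.
Qed.

(** Union bound over [r]-tuples of fingerprint and container: the image contains the fingerprints
    and avoids the points left uncovered, at least [d] by supersaturation. *)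
Lemma prob_not_rado_le r t d (L : R) (E := (4 * r * (2 * r) ^ (2 * r))%N)
    (k := (32 * E * ((8 * E + 1) * t))%N) :
  (0 < r)%N -> 1 <= L -> (0 < t)%N -> (N <= t * t)%N -> (16 * E <= N)%N ->
  (4 * (2 * r) ^ r * (d + 1 + r * k) <= N)%N ->
  prob_random_subset p (fun S : {set G} => ~~ is_rado A22m2 r S) <=
    (L ^+ k * (1 + q / L) ^+ N) ^+ r * (1 - p) ^+ (f * d).
Proof.
move=> r0 L1 t0 tN EN dN.
have E0 : (0 < E)%N by rewrite !muln_gt0 expn_gt0 muln_gt0 r0.
have [l [suml inl contl]] := sum_containers_exist V2 q0 L1 t0 tN E0 EN.
pose x (j : 'I_(size l)) := tnth (in_tuple l) j.
pose U (g : {ffun 'I_r -> 'I_(size l)}) := \bigcup_i (x (g i)).1.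
(* The point 0 is excluded because the colour classes omit it. *)
pose D (g : {ffun 'I_r -> 'I_(size l)}) :=
  ~: (0 |: (U g :|: \bigcup_i (x (g i)).2)).
(* Equality of cardinals says that the fingerprints are disjoint, so that [q ^+ #|U g|] factors over
   the colours. *)
pose F (g : {ffun 'I_r -> 'I_(size l)}) (S : {set G}) :=
  (#|U g| == \sum_i #|(x (g i)).1|)%N &&
  (all (mem (pi @: S)) (enum (U g)) && [disjoint pi @: S & D g]).
have xl j : x j \in l by exact: mem_tnth.
apply: (@le_trans _ _ (prob_random_subset p
   (fun S => has (fun g => F g S) (enum {: {ffun 'I_r -> 'I_(size l)}})))).
  apply: (prob_sub p01) => S nS.
  have [col sf] := not_rado_colouring r0 nS.
  have /fin_all_exists[g hg] : forall i : 'I_r, exists j : 'I_(size l),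
      (x j).1 \subset [set v in pi @: S | (col v == i) && (v != 0)] /\
      [set v in pi @: S | (col v == i) && (v != 0)] \subset (x j).1 :|: (x j).2.
    move=> i; have [y yl [h1 h2]] := contl _ (sf i) (sub0set _).
    have /tnthP[j yj] : y \in in_tuple l by [].
    by exists j; rewrite /x -yj; split => //; move: h2; rewrite setIT.
  apply/hasP; exists (finfun g); first by rewrite mem_enum.
  apply/and3P; split.
  - apply/eqP; rewrite -sum1_card /U partition_disjoint_bigcup /=.
      by apply: eq_bigr => i _; rewrite sum1_card.
    move=> i j ij; rewrite !ffunE -setI_eq0; apply/eqP/setP => v; rewrite inE in_set0.
    apply/negP => /andP[/(subsetP (hg i).1)]; rewrite !inE => /and3P[_ /eqP ci _].
    move=> /(subsetP (hg j).1); rewrite !inE => /and3P[_ /eqP cj _].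
    by move: ij; rewrite -ci -cj eqxx.
  - apply/allP => v; rewrite mem_enum => /bigcupP[i _].
    by rewrite ffunE => /(subsetP (hg i).1); rewrite !inE => /and3P[].
  - rewrite -setI_eq0; apply/eqP/setP => v; rewrite in_setI in_set0.
    apply/negP => /andP[vS]; rewrite !inE !negb_or => /and3P[v0 vU vC].
    have hv : v \in [set u in pi @: S | (col u == col v) && (u != 0)] by rewrite inE vS eqxx.
    have := subsetP (hg (col v)).2 _ hv; rewrite in_setU => /orP[] h.
      by move/negP: vU; case; apply/bigcupP; exists (col v); rewrite ?ffunE.
    by move/negP: vC; case; apply/bigcupP; exists (col v); rewrite ?ffunE.
apply: le_trans (prob_has p01 _ _) _; rewrite big_enum /=.
have q1 : (1 - p) ^+ (f * d) >= 0 by rewrite exprn_ge0.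
apply: (@le_trans _ _ (\sum_(g : {ffun 'I_r -> 'I_(size l)})
   (\prod_i q ^+ #|(x (g i)).1|) * (1 - p) ^+ (f * d))).
  apply: ler_sum => g _.
  have dD : (d <= #|D g|)%N.
    have small i : (E * schur_pairs (x (g i)).2 < N ^ 2)%N by case: (inl _ (xl (g i))).
    have := schur_supersaturation V2 r0 small; set W := \bigcup_i _ => hW.
    have cU : (#|U g| <= r * k)%N.
      apply: (@leq_trans (\sum_(i < r) #|(x (g i)).1|)).
        rewrite /U; elim/big_rec2: _ => [|i m B _ h]; first by rewrite cards0.
        by apply: leq_trans (leq_card_setU _ _) _; rewrite leq_add2l.
      rewrite -[X in (X * _)%N]card_ord -sum_nat_const; apply: leq_sum => i _.
      by case: (inl _ (xl (g i))).
    have cW : (#|~: W| <= #|D g| + 1 + #|U g|)%N.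
      have sub : ~: W \subset (D g :|: [set 0]) :|: U g.
        apply/subsetP => v; rewrite !inE => vW; rewrite -/W (negbTE vW) orbF negb_or.
        by case: (v == 0); case: (v \in U g).
      apply: leq_trans (subset_leq_card sub) _; apply: leq_trans (leq_card_setU _ _) _.
      rewrite leq_add2r -(cards1 (0 : V)); exact: leq_card_setU.
    have P0 : (0 < 4 * (2 * r) ^ r)%N by rewrite muln_gt0 expn_gt0 muln_gt0 r0.
    have := leq_ltn_trans dN hW; rewrite ltn_pmul2l // => h.
    by move: h cW cU; clear; lia.
  have pd : (1 - p) ^+ (f * #|D g|) <= (1 - p) ^+ (f * d).
    apply: ler_wiXn2l => //; first by rewrite lerBlDr lerDl.
    by rewrite leq_mul2l dD orbT.
  rewrite /F; case: eqP => [eU|_] /=; last first.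
    rewrite /prob_random_subset [leLHS]big_pred0 //.
    by apply: mulr_ge0 => //; apply: prodr_ge0 => i _; rewrite exprn_ge0.
  have := prob_fibres p01 fibre (enum_uniq (U g)) (D := D g).
  rewrite -cardE eU -/q => h; apply: le_trans (h _) _.
    by move=> v; rewrite mem_enum !inE negbK => ->; rewrite orbT.
  by rewrite -(big_morph _ (exprD q) (expr0 q)) ler_wpM2l // exprn_ge0.
rewrite -mulr_suml ler_wpM2r //.
(* The sum over [g] of products is the [r]-th power of the weighted sum over the list. *)
rewrite -(bigA_distr_bigA (fun (_ : 'I_r) j => q ^+ #|(x j).1|)) prodr_const card_ord.
have -> : \sum_j q ^+ #|(x j).1| = \sum_(y <- l) q ^+ #|y.1| by rewrite [RHS]big_tnth.
rewrite cardsT in suml.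
have s0 : 0 <= \sum_(y <- l) q ^+ #|y.1| by apply: sumr_ge0 => y _; rewrite exprn_ge0.
by apply: lerXn2r => //; rewrite nnegrE // (le_trans s0).
Qed.

End Reduction.

(** * Reduction of the group modulo 2 *)

Definition parity (a : 'Z_4) : 'Z_2 := (a : nat)%:R.

Lemma parity_is_zmod_morphism : zmod_morphism parity.
Proof. by do 2 case=> [[|[|[|[|?]]]]] // ?; apply/eqP. Qed.

HB.instance Definition _ := GRing.isZmodMorphism.Build _ _ parity parity_is_zmod_morphism.

Section Parity.
Variable n : nat.
Let pi := map_mx parity : 'rV['Z_4]_n -> 'rV['Z_2]_n.

Lemma row2_addxx (x : 'rV['Z_2]_n) : x + x = 0.
Proof. by apply/matrixP => i j; rewrite !mxE; case: (x i j) => [[|[|?]]] // ?; apply/eqP. Qed.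

Lemma parity_mx_eq0 x : (pi x == 0) = (x *+ 2 == 0).
Proof.
have e (a : 'Z_4) : (parity a == 0) = (a *+ 2 == 0) by case: a => [[|[|[|[|?]]]]].
apply/eqP/eqP => /matrixP h; apply/matrixP => i j; have := h i j.
  by rewrite mulr2n !mxE -mulr2n => /eqP; rewrite e => /eqP.
by rewrite mulr2n !mxE -mulr2n => /eqP; rewrite -e => /eqP.
Qed.

Lemma card_row2 : #|{: 'rV['Z_2]_n}| = (2 ^ n)%N.
Proof. by rewrite card_mx card_ord mul1n. Qed.

(** All fibres are translates of the kernel by the section [sg], so [2 ^ n] equal fibres share
    [4 ^ n] elements. *)
Lemma card_parity_fibre v : #|[set x | pi x == v]| = (2 ^ n)%N.
Proof.
pose sg (u : 'rV['Z_2]_n) : 'rV['Z_4]_n := map_mx (fun b : 'Z_2 => (b : nat)%:R) u.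
have sgK u : pi (sg u) = u.
  apply/matrixP => i j; rewrite !mxE; case: (u i j) => [[|[|?]]] // ?; exact/eqP.
have piB x y : pi (x - y) = pi x - pi y by exact: raddfB.
have piD x y : pi (x + y) = pi x + pi y by exact: raddfD.
have card_f u : #|[set x | pi x == u]| = #|[set x | pi x == 0]|.
  rewrite -[RHS](card_imset _ (addrI (sg u))); apply: eq_card => x; rewrite !inE.
  apply/idP/imsetP => [/eqP xu|[y]].
    exists (x - sg u); last by rewrite addrC subrK.
    by rewrite inE piB xu sgK subrr.
  by rewrite inE => /eqP y0 ->; rewrite piD sgK y0 addr0.
have tot : (2 ^ n * #|[set x | pi x == v]| = 2 ^ n * 2 ^ n)%N.
  rewrite -expnMn -[RHS](_ : #|{: 'rV['Z_4]_n}| = _); last by rewrite card_mx card_ord mul1n.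
  rewrite -[RHS]sum1_card (partition_big pi predT) //= -card_row2 -sum_nat_const.
  by apply: eq_bigr => u _; rewrite card_f -(card_f u) -sum1_card; apply: eq_bigl => x; rewrite inE.
by apply/eqP; rewrite -(eqn_pmul2l (_ : 0 < 2 ^ n)%N) ?expn_gt0 // tot.
Qed.

End Parity.

From mathcomp Require Import all_classical all_reals all_analysis.
Import numFieldNormedType.Exports.
Local Open Scope classical_set_scope.

(** * Choice of constants and limits *)

Section Asymptotics.
Variable R : realType.

Let le_of_eq (x y : R) : x = y -> x <= y. Proof. by move->. Qed.

(** The square root of [N = 2 ^ n]; the threshold is the inverse of its cube. *)
Let s n : R := Num.sqrt 2 ^+ n.

Let s_gt0 n : 0 < s n.
Proof. by rewrite exprn_gt0 // sqrtr_gt0. Qed.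

Let s_sqr n : (2 ^ n)%:R = s n ^+ 2.
Proof. by rewrite natrX /s -exprM mulnC exprM sqr_sqrtr. Qed.

Lemma powR_threshold n : 4 `^ (- (3 * n%:R / 4)) = (s n ^+ 3)^-1.
Proof.
rewrite [X in X `^ _](_ : _ = Num.sqrt 2 `^ 4%:R); last first.
  by rewrite powR_mulrn ?sqrtr_ge0 // (exprM _ 2 2) sqr_sqrtr // expr2; ring.
rewrite -powRrM (_ : 4%:R * _ = - (n * 3)%:R); last by rewrite natrM; field.
by rewrite powRN powR_mulrn ?sqrtr_ge0 // /s exprM.
Qed.

Lemma cvg_inv_s (u : nat -> R) : (forall n, 0 <= u n) ->
  (\forall n \near \oo, u n <= (s n)^-1) -> u n @[n --> \oo] --> (0 : R).
Proof.
move=> u0 us.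
have inv_s : (s n)^-1 @[n --> \oo] --> (0 : R).
  have -> : (fun n => (s n)^-1) = geometric 1 (Num.sqrt 2)^-1.
    by apply/funext => n; rewrite /geometric /= mul1r /s exprVn.
  apply: cvg_geometric; rewrite ger0_norm ?invr_ge0 ?sqrtr_ge0 //.
  by rewrite invf_lt1 ?sqrtr_gt0 // -{1}sqrtr1 ltr_sqrt // ltr1n.
apply: (squeeze_cvgr _ (cvg_cst 0) inv_s).
by near=> n; rewrite u0 /=; near: n.
Unshelve. all: by end_near.
Qed.

(** The constant 1/4 gives [q] at most [1 / (4 * s n)], hence [8 * N * q ^ 2] at most 1/2 and
    [3 * q] below [1 / s n]. *)
Lemma prob_rado_small (r n : nat) (p : R) : (2 <= r)%N -> 0 <= p <= 1 ->
  p <= 4^-1 * 4 `^ (- (3 * n%:R / 4)) ->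
  prob_random_subset p (fun S : {set 'rV['Z_4]_n} => is_rado A22m2 r S) <= (s n)^-1.
Proof.
move=> r2 p01; rewrite powR_threshold => hp.
have sn := s_gt0 n; set q := (2 ^ n)%:R * p.
have q0 : 0 <= q by rewrite mulr_ge0 //; case/andP: p01.
have hq : q <= 4^-1 * (s n)^-1.
  rewrite /q s_sqr; apply: (@le_trans _ _ (s n ^+ 2 * (4^-1 * (s n ^+ 3)^-1))).
    by rewrite ler_wpM2l // exprn_ge0 // ltW.
  by apply: le_of_eq; field; rewrite gt_eqF.
have := prob_rado_le (@row2_addxx n) (@parity_mx_eq0 n) p01 (@card_parity_fibre n) r2.
rewrite card_row2 -/q => H; apply: le_trans (H _) _; last first.
  apply: (@le_trans _ _ (3 * (4^-1 * (s n)^-1))); first by rewrite ler_wpM2l.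
  have : 0 < (s n)^-1 by rewrite invr_gt0.
  by lra.
rewrite s_sqr; apply: (@le_trans _ _ (8 * s n ^+ 2 * (4^-1 * (s n)^-1) ^+ 2)).
  apply: ler_wpM2l; first by rewrite mulr_ge0 // exprn_ge0 // ltW.
  by apply: lerXn2r; rewrite ?nnegrE // (le_trans q0).
by apply: le_of_eq; field; rewrite gt_eqF.
Qed.

Section Large.
Variable r : nat.
Hypothesis r_gt0 : (0 < r)%N.
Let Q := ((2 * r) ^ r)%N.
Let E := (4 * r * (2 * r) ^ (2 * r))%N.
Let K := (32 * E * (8 * E + 1))%N.
Let L := (64 * Q * r)%N.
(** Let [y = N ^ 2 * p]. Avoidance contributes at most [- y / (16 * Q)] to the exponent; [L] makes
    the factor from [1 + q / L] cost only a quarter of that, [y / (64 * Q)], and the constant makes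
    this quarter exceed the cost [2 * r * K * L * s n] of [L ^ k] by [s n]. *)
Definition large_const : R := (64 * Q * (2 * r * K * L + 1))%:R.

Let Q_gt0 : (0 < Q)%N. Proof. by rewrite expn_gt0 muln_gt0 r_gt0. Qed.

Lemma prob_not_rado_large (n : nat) (p : R) : 0 <= p <= 1 ->
  (8 * Q * (1 + r * K) + 16 * E <= n./2)%N ->
  large_const * 4 `^ (- (3 * n%:R / 4)) <= p ->
  prob_random_subset p (fun S : {set 'rV['Z_4]_n} => ~~ is_rado A22m2 r S) <= (s n)^-1.
Proof.
move=> p01 nB; rewrite powR_threshold => hp.
have sn := s_gt0 n; set N := (2 ^ n)%N; set t := (2 ^ uphalf n)%N.
(* Half of the [N / (4 * Q)] uncovered points; the other half absorbs 0 and the fingerprints. *)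
set d := (N %/ (8 * Q))%N.
have hn : (n = n./2 + uphalf n)%N by rewrite uphalf_half addnCA addnn odd_double_half.
have hh : (8 * Q * (1 + r * K) + 16 * E <= 2 ^ n./2)%N.
  by apply: leq_trans nB _; rewrite ltnW // ltn_expl.
have Nt : N = (2 ^ n./2 * t)%N by rewrite /N /t -expnD -hn.
have t0 : (0 < t)%N by rewrite expn_gt0.
have Q8 : (0 < 8 * Q)%N by rewrite muln_gt0 Q_gt0.
have tN : (N <= t * t)%N.
  by rewrite Nt leq_mul2r leq_pexp2l ?orbT // uphalf_half leq_addl.
have EN : (16 * E <= N)%N by rewrite Nt; move: hh t0; clear; nia.
have big : (8 * Q * (1 + r * K * t) <= N)%N by rewrite Nt; move: hh t0; clear; nia.
have dN : (4 * Q * (d + 1 + r * (32 * E * ((8 * E + 1) * t))) <= N)%N.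
  have : (8 * Q * d <= N)%N by rewrite mulnC leq_trunc_div.
  by rewrite (mulnA (32 * E)%N) -/K; move: big; clear; nia.
have Nd : (N <= 16 * Q * d)%N.
  have d1 : (0 < d)%N by rewrite divn_gt0 // (leq_trans _ big) // leq_pmulr.
  by have := ltn_ceil N Q8; rewrite -/d; move: d1; clear; nia.
have L1 : 1 <= L%:R :> R.
  by rewrite (ler_nat _ 1) !muln_gt0 Q_gt0 r_gt0.
have := prob_not_rado_le (@row2_addxx n) (@parity_mx_eq0 n) p01 (@card_parity_fibre n)
  r_gt0 L1 t0 (d := d).
rewrite card_row2 -/N -/E -/Q => /(_ tN EN dN); move/le_trans; apply.
rewrite (mulnA (32 * E)%N) -/K; set q := N%:R * p.
have [p0 p1] := andP p01.
have q0 : 0 <= q by rewrite mulr_ge0.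
have LR : 0 < L%:R :> R by apply: lt_le_trans L1.
have bL : L%:R ^+ (K * t) <= expR ((K * t)%:R * L%:R) :> R.
  rewrite expRM_natl lerXn2r ?nnegrE ?expR_ge0 ?ler0n //.
  by apply: le_trans (expR_ge1Dx _); rewrite lerDr.
have bq : (1 + q / L%:R) ^+ N <= expR (N%:R * (q / L%:R)).
  have h0 : 0 <= q / L%:R by rewrite divr_ge0.
  by rewrite expRM_natl lerXn2r ?nnegrE ?expR_ge0 ?addr_ge0 // expR_ge1Dx.
have bp : (1 - p) ^+ (N * d) <= expR ((N * d)%:R * - p).
  by rewrite expRM_natl lerXn2r ?nnegrE ?expR_ge0 ?subr_ge0 // expR_ge1Dx.
apply: (@le_trans _ _ (expR (r%:R * ((K * t)%:R * L%:R + N%:R * (q / L%:R)) + (N * d)%:R * - p))).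
  have h0 : 0 <= 1 + q / L%:R by rewrite addr_ge0 // divr_ge0.
  rewrite expRD expRM_natl expRD; apply: ler_pM => //.
  - by rewrite exprn_ge0 // mulr_ge0 // exprn_ge0.
  - by rewrite exprn_ge0 // subr_ge0.
  - by rewrite lerXn2r ?nnegrE ?mulr_ge0 ?exprn_ge0 ?expR_ge0 // ler_pM ?exprn_ge0.
apply: (@le_trans _ _ (expR (- s n))); last first.
  rewrite expRN lef_pV2 ?posrE ?expR_gt0 //.
  by apply: le_trans (expR_ge1Dx _); rewrite lerDr.
rewrite ler_expR.
have ts : t%:R <= 2 * s n.
  rewrite -(ler_pXn2r (_ : 0 < 2)%N) ?nnegrE ?mulr_ge0 ?(ltW sn) //.
  rewrite exprMn -s_sqr -!natrX -natrM ler_nat /t -expnM -expnD leq_pexp2l //.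
  by rewrite uphalf_half; have := odd_double_half n; clear; lia.
set y := N%:R * N%:R * p.
have ys : large_const * s n <= y.
  rewrite /y /N s_sqr -expr2 -exprM /=.
  apply: (@le_trans _ _ (s n ^+ 4 * (large_const * (s n ^+ 3)^-1))).
    by apply: le_of_eq; field; rewrite gt_eqF.
  by rewrite ler_wpM2l // exprn_ge0 // ltW.
have Q0 : 0 < Q%:R :> R by rewrite ltr0n.
have r0R : 0 < r%:R :> R by rewrite ltr0n.
have e1 : r%:R * (N%:R * (q / L%:R)) = y / (64 * Q%:R).
  by rewrite /q /y /L !natrM; field; rewrite !gt_eqF.
have e2 : y / (16 * Q%:R) <= (N * d)%:R * p.
  rewrite ler_pdivrMr ?mulr_gt0 // /y natrM.
  have : N%:R <= (16 * Q * d)%:R :> R by rewrite ler_nat.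
  rewrite !natrM => h.
  have := ler_wpM2l (_ : 0 <= N%:R * p) h; rewrite mulr_ge0 // => /(_ isT).
  by congr (_ <= _); ring.
have e3 : r%:R * ((K * t)%:R * L%:R) <= (2 * r * K * L)%:R * s n.
  have -> : r%:R * ((K * t)%:R * L%:R) = (r * K * L)%:R * t%:R :> R by rewrite !natrM; ring.
  apply: (@le_trans _ _ ((r * K * L)%:R * (2 * s n))); first by rewrite ler_wpM2l.
  by rewrite !natrM; apply: le_of_eq; ring.
have e4 : ((2 * r * K * L)%:R + 1) * s n <= y / (64 * Q%:R).
  rewrite ler_pdivlMr ?mulr_gt0 //; apply: le_trans ys; apply: le_of_eq.
  by rewrite /large_const !(natrM, natrD); ring.
have e5 : y / (16 * Q%:R) = 4 * (y / (64 * Q%:R)) by field; rewrite gt_eqF.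
have a0 : 0 <= (2 * r * K * L)%:R * s n by rewrite mulr_ge0 // ltW.
rewrite e5 in e2; rewrite mulrDl mul1r in e4; rewrite mulrDr e1 mulrN.
move: sn a0 e2 e3 e4; clear.
move: (s n) (y / _) ((2 * r * K * L)%:R * s n) (r%:R * _) ((N * d)%:R * p) => z Y A B D.
lra.
Qed.

End Large.
End Asymptotics.

Theorem theorem5p2 (R : realType) (r : nat) (hr : (2 <= r)%N) :
  exists c C : R, [/\ 0 < c, 0 < C &
    forall p : nat -> R, (forall n, 0 <= p n <= 1) ->
      ((\forall n \near \oo, p n <= c * 4 `^ (- (3 * n%:R / 4))) ->
        prob_random_subset (p n)
          (fun S : {set 'rV['Z_4]_n} => is_rado A22m2 r S) @[n --> \oo] --> (0 : R))
      /\
      ((\forall n \near \oo, C * 4 `^ (- (3 * n%:R / 4)) <= p n) ->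
        prob_random_subset (p n)
          (fun S : {set 'rV['Z_4]_n} => is_rado A22m2 r S) @[n --> \oo] --> (1 : R))].
Proof.
have r0 : (0 < r)%N by apply: ltnW.
exists 4^-1, (large_const R r); split; first by rewrite invr_gt0.
  by rewrite ltr0n !muln_gt0 expn_gt0 muln_gt0 r0 addn1.
move=> p p01; split => hp.
  apply: cvg_inv_s => [n|]; first exact: prob_ge0.
  by near=> n; apply: prob_rado_small => //; near: n.
suff h : prob_random_subset (p n)
    (fun S : {set 'rV['Z_4]_n} => ~~ is_rado A22m2 r S) @[n --> \oo] --> (0 : R).
  under eq_fun do rewrite prob_predC //.
  have := cvgB (@cvg_cst _ (1 : R) _ \oo _) h; rewrite subr0; exact.
apply: cvg_inv_s => [n|]; first exact: prob_ge0.
near=> n; apply: prob_not_rado_large => //; last by near: n.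
rewrite geq_half_double; near: n; exact: nbhs_infty_ge.
Unshelve. all: by end_near.
Qed.
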